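(* Let $H,H'$ be discretely valued hyperfields which are not fields and let $f:H\to H'$ be a morphism of valued hyperfields. Then $\mathrm{Tr}(f)=(r,\phi,\eta)$ is a morphism of triples $\mathrm{Tr}(H)\to\mathrm{Tr}(H')$.
   Context: A hyperfield is a set $H$ with a multivalued addition $+:H\times H\to 2^H$ and a single-valued multiplication such that: $(x+y)+z=x+(y+z)$ for all $x,y,z$, where $(x+y)+z:=\bigcup_{t\in x+y}(t+z)$ and similarly on the right; $x+y=y+x$; there is $0\in H$ with $x+0=\{x\}$ for all $x$; for every $x$ there is a unique $-x$ with $0\in x+(-x)$; $x\in y-z$ iff $y\in x+z$ (where $y-z:=y+(-z)$); multiplication is commutative, associative, unital, with $(x+y)z\subseteq xz+yz$; $0\neq 1$ and every nonzero element is invertible. For subsets, $A+B=\bigcup_{a\in A,b\in B}(a+b)$. A hyperfield ''is a field'' if all its sums are singletons. A valued hyperfield is a hyperfield with a map $|\cdot|:H\to\mathbb{R}$ such that (i) $|x|\ge0$ with equality iff $x=0$; (ii) $|xy|=|x||y|$; (iii) $|z|\le\max(|x|,|y|)$ for all $z\in x+y$; (iv) $|\cdot|$ is constant on $x+y$ unless $0\in x+y$ (this gives a metric $d(x,y)=|z|$ for any $z\in x-y$ when $x\neq y$, $d(x,x)=0$); (v) there is a real $\rho>0$ such that either $x+y$ is a closed ball of radius $\rho\max(|x|,|y|)$ for all $x,y$, or $x+y$ is an open ball of radius $\rho\max(|x|,|y|)$ for all $x,y$; the smallest such $\rho$ is denoted $\rho_H$. $H$ is discretely valued if $0$ is the only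 non-isolated point of $\{|x|:x\in H\}$. A morphism of valued hyperfields $f:H_1\to H_2$ is a map with $f(xy)=f(x)f(y)$, $f^{-1}(a+b)=f^{-1}(a)+f^{-1}(b)$ for all $a,b\in f(H_1)$, $|f(x)|=|x|$, and $f^{-1}(1)$ a ball. For $H$ discretely valued and not a field: $\theta_H$ is the smallest element of $\{|x|:x\neq0\}$ less than $1$; a uniformizer is $\pi$ with $|\pi|=\theta_H$; $\mathcal{O}_H$ is the closed ball of radius $1$ about $0$ and $\mathfrak{m}_H^k$ the closed ball of radius $\theta_H^k$ about $0$. Triples: a truncated DVR is a local Artinian ring $R$ whose maximal ideal $\mathfrak{m}_R$ is principal. A triple $(R,M,\epsilon)$ is a truncated DVR $R$, a free $R$-module $M$ of rank $1$, and an $R$-linear $\epsilon:M\to R$ with image $\mathfrak{m}_R$. For integers $s\ge r$, $\epsilon_{r,s}:M^{\otimes s}\to M^{\otimes r}$ is the $R$-linear map with $x^{\otimes s}\mapsto\epsilon(x)^{s-r}x^{\otimes r}$ for a generator $x$. A morphism $(r,f,\eta):(R,M,\epsilon)\to(R',M',\epsilon')$ is a ring homomorphism $f:R\to R'$, an integer $r$, and an $R$-linear $\eta:M\to M'^{\otimes r}$ with $f\circ\epsilon=\epsilon'_{0,r}\circ\eta$ and such that the induced map $M\otimes_RR'\to M'^{\otimes r}$ is an isomorphism. Construction: for $H$ and $i\in\mathbb{Z}$, let $M_i=\mathfrak{m}_H^i/\!\sim$ where $x\sim y$ iff $d(x,y)\le\rho_H\theta_H^i$; the sum of classes of $\hat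 x,\hat y$ is the class of any element of $\hat x+\hat y$, and products of lifts give $M_i\times M_j\to M_{i+j}$. Put $R=M_0$, $M=M_1$; for a uniformizer $\pi$, $M_i$ is identified with $M^{\otimes i}$ by sending the class of $\pi^i$ to $\bar\pi^{\otimes i}$. $\epsilon:M\to R$ sends the class of $\hat x\in\mathfrak{m}_H$ to the class of $\hat x$ in $R$. $\mathrm{Tr}(H)=(R,M,\epsilon)$; $(R',M',\epsilon')=\mathrm{Tr}(H')$ similarly. $\mathrm{Tr}(f)=(r,\phi,\eta)$ where $r=\log\theta_H/\log\theta_{H'}$, $\phi:R\to R'$ sends the class of $\hat x\in\mathcal{O}_H$ to the class of $f(\hat x)$, and $\eta:M\to M'^{\otimes r}\cong M'_r$ sends the class of $\hat x\in\mathfrak{m}_H$ to the class of $f(\hat x)\in\mathfrak{m}_{H'}^r$.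
   Formalization: θ_H is taken to be the largest (not the smallest, which does not exist) norm of a nonzero element less than 1, and the open-ball alternative in axiom (v) is not required for the sum 0+0, since an open ball of radius 0 is empty. *)

(* Defs.v *)
From HB Require Import structures.
From mathcomp Require Import all_boot all_order all_algebra.
From mathcomp Require Import boolp classical_sets functions reals topology
  normedtype sequences exp.

Set Implicit Arguments.
Unset Strict Implicit.
Unset Printing Implicit Defensive.

Import Order.TTheory GRing.Theory Num.Theory numFieldNormedType.Exports.

Local Open Scope classical_set_scope.
Local Open Scope ring_scope.
Local Open Scope quotient_scope.

HB.mixin Record isHyperfield H of Choice H := {
  hadd : H -> H -> set H;
  hmul : H -> H -> H;
  hopp : H -> H;
  h0 : H;
  h1 : H;
  haddA : forall x y z,
    \bigcup_(t in hadd x y) hadd t z = \bigcup_(t in hadd y z) hadd x t;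
  haddC : forall x y, hadd x y = hadd y x;
  haddr0 : forall x, hadd x h0 = [set x];
  hadd_eq0 : forall x y, hadd x y h0 <-> y = hopp x;
  hadd_rev : forall x y z, hadd y (hopp z) x <-> hadd x z y;
  hmulC : forall x y, hmul x y = hmul y x;
  hmulA : forall x y z, hmul x (hmul y z) = hmul (hmul x y) z;
  hmul1 : forall x, hmul h1 x = x;
  hmulDl : forall x y z,
    [set hmul t z | t in hadd x y] `<=` hadd (hmul x z) (hmul y z);
  h0_neq1 : h0 != h1;
  hmul_inv : forall x, x != h0 -> exists y, hmul x y = h1
}.

#[short(type="hyperfieldType")]
HB.structure Definition Hyperfield := {H of isHyperfield H & Choice H}.

Section HyperfieldTheory.
Variable H : hyperfieldType.
Implicit Types (x y z t : H) (A B : set H).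

Definition hsub x y := hadd x (hopp y).

Definition hset_add A B := \bigcup_(a in A) \bigcup_(b in B) hadd a b.

Definition is_field := forall x y, exists z, hadd x y = [set z].

Definition hinv x : H := xget h0 [set y | hmul x y = h1].

Definition hexp x (n : nat) := iter n (hmul x) h1.

Definition hexpz x (i : int) :=
  match i with Posz n => hexp x n | Negz n => hinv (hexp x n.+1) end.

Lemma hopp_uniq x y : hadd x y h0 -> y = hopp x.
Proof. by move/hadd_eq0. Qed.

Lemma hsubrr x : hsub x x h0.
Proof. exact/hadd_eq0. Qed.

Lemma hoppK x : hopp (hopp x) = x.
Proof. by apply/esym/hopp_uniq; rewrite haddC; exact: hsubrr. Qed.

Lemma hadd0r x : hadd h0 x = [set x].
Proof. by rewrite haddC haddr0. Qed.

Lemma hopp0 : hopp h0 = h0 :> H.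
Proof. by apply/esym/hopp_uniq; rewrite haddr0. Qed.

Lemma hadd_nonempty x y : hadd x y !=set0.
Proof.
apply/set0P/eqP => xy0.
have := haddA x y (hopp y); rewrite xy0 bigcup_set0 => /esym e.
have : (\bigcup_(t in hadd y (hopp y)) hadd x t) x.
  by exists h0; [exact: hsubrr|rewrite haddr0].
by rewrite e.
Qed.

Lemma hsub_eq0 x y : hsub x y h0 -> x = y.
Proof. by move/hopp_uniq/(congr1 (@hopp H)); rewrite !hoppK. Qed.

Lemma haddAP x y z t : (exists2 u, hadd x y u & hadd u z t) <->
  (exists2 u, hadd y z u & hadd x u t).
Proof.
have /seteqP[hl hr] := haddA x y z; split=> -[u a b].
  by have [|v ? ?] := hl t; [exists u|exists v].
by have [|v ? ?] := hr t; [exists u|exists v].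
Qed.

Lemma hmul1r x : hmul x h1 = x.
Proof. by rewrite hmulC hmul1. Qed.

Lemma hmul_Dl x y z t : hadd x y t -> hadd (hmul x z) (hmul y z) (hmul t z).
Proof. by move=> h; apply: hmulDl; exists t. Qed.

End HyperfieldTheory.
Arguments is_field : clear implicits.

HB.mixin Record hasHyperNorm (R : realType) H of Hyperfield H := {
  habs : H -> R;
  habs_ge0 : forall x, 0 <= habs x;
  habs_eq0 : forall x, habs x = 0 <-> x = h0;
  habsM : forall x y, habs (hmul x y) = habs x * habs y;
  habsD : forall x y z, hadd x y z -> habs z <= Num.max (habs x) (habs y);
  habs_const : forall x y, ~ hadd x y h0 ->
    forall z t, hadd x y z -> hadd x y t -> habs z = habs t
}.

#[short(type="normedHyperfieldType")]
HB.structure Definition NormedHyperfield (R : realType) :=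
  {H of hasHyperNorm R H & Hyperfield H}.

Section Distance.
Variables (R : realType) (H : normedHyperfieldType R).
Implicit Types (x y z t : H) (A : set H).

(* For x <> y the norm is constant on x - y, so the element chosen by xget does
   not matter; see hdistE. *)
Definition hdist x y : R := if x == y then 0 else habs (xget h0 (hsub x y)).

Definition cball x (r : R) : set H := [set y | hdist x y <= r].
Definition oball x (r : R) : set H := [set y | hdist x y < r].

Definition is_cball (r : R) A := exists x, A = cball x r.
Definition is_oball (r : R) A := exists x, A = oball x r.

Definition is_ball A := exists r : R, 0 <= r /\ (is_cball r A \/ is_oball r A).

(* The open ball of radius 0 is empty, hence 0 + 0 = {0} has to be left out of
   the second alternative. *)
Definition sum_radius (rho : R) := 0 < rho /\
  ((forall x y, is_cball (rho * Num.max (habs x) (habs y)) (hadd x y)) \/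
   (forall x y, ~~ ((x == h0) && (y == h0)) ->
      is_oball (rho * Num.max (habs x) (habs y)) (hadd x y))).

Lemma habs0 : habs (h0 : H) = 0.
Proof. exact/habs_eq0. Qed.

Lemma habs_gt0 x : (0 < habs x) = (x != h0).
Proof.
rewrite lt_def habs_ge0 andbT; congr (~~ _).
by apply/eqP/eqP => /habs_eq0.
Qed.

Lemma habs1 : habs (h1 : H) = 1.
Proof.
have n0 : habs (h1 : H) != 0 by rewrite gt_eqF// habs_gt0 eq_sym h0_neq1.
by apply: (mulfI n0); rewrite mulr1 -habsM hmul1.
Qed.

Lemma hmul0 x : hmul h0 x = h0.
Proof. by apply/habs_eq0; rewrite habsM habs0 mul0r. Qed.

Lemma hmulNr x y : hmul (hopp x) y = hopp (hmul x y).
Proof.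
by apply: hopp_uniq; rewrite -[X in hadd _ _ X](hmul0 y); apply/hmul_Dl/hsubrr.
Qed.

Lemma hmulrN x y : hmul x (hopp y) = hopp (hmul x y).
Proof. by rewrite hmulC hmulNr hmulC. Qed.

Lemma habsN x : habs (hopp x) = habs x.
Proof.
have N1 : habs (hopp h1 : H) = 1.
  have : habs (hopp h1 : H) ^+ 2 = 1 by rewrite expr2 -habsM hmulNr hmulrN hoppK hmul1 habs1.
  by move/eqP; rewrite sqrf_eq1 => /orP[/eqP//|/eqP e]; have := habs_ge0 (hopp h1 : H);
     rewrite e oppr_ge0 ler10.
by rewrite -[in LHS](hmul1 x) -hmulNr habsM N1 mul1r.
Qed.

Lemma hopp_add x y z : hadd x y z -> hadd (hopp x) (hopp y) (hopp z).
Proof.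
move=> h; rewrite -(hmul1r x) -(hmul1r y) -(hmul1r z) -!hmulrN; exact: hmul_Dl.
Qed.

Lemma hsub_sym x y z : hsub x y z -> hsub y x (hopp z).
Proof. by rewrite /hsub => /hopp_add; rewrite hoppK haddC. Qed.

Lemma hdistxx x : hdist x x = 0.
Proof. by rewrite /hdist eqxx. Qed.

Lemma hdistE x y z : x != y -> hsub x y z -> hdist x y = habs z.
Proof.
move=> xy hz; rewrite /hdist (negbTE xy); apply: (@habs_const _ _ x (hopp y)) => //.
  by move/hsub_eq0/eqP; rewrite (negbTE xy).
by apply: (xgetI _ hz).
Qed.

Lemma hdist_ex x y : exists2 z, hsub x y z & hdist x y = habs z.
Proof.
have [<-|xy] := eqVneq x y; first by exists h0; [exact: hsubrr|rewrite hdistxx habs0].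
have [z hz] := hadd_nonempty x (hopp y).
by exists z => //; exact: hdistE.
Qed.

Lemma hdist_le x y z : hsub x y z -> hdist x y <= habs z.
Proof.
by move=> hz; have [<-|xy] := eqVneq x y; [rewrite hdistxx habs_ge0|rewrite (hdistE xy hz)].
Qed.

Lemma hdist_addl x y z : hadd x y z -> hdist z x <= habs y.
Proof. by rewrite haddC => h; apply: hdist_le; apply/hadd_rev. Qed.

Lemma hdist_sym x y : hdist x y = hdist y x.
Proof.
have [<-//|xy] := eqVneq x y.
have [z hz ->] := hdist_ex x y.
by rewrite (@hdistE y x (hopp z)) ?habsN// 1?eq_sym//; exact: hsub_sym.
Qed.

Lemma hdist0 x : hdist x h0 = habs x.
Proof.
have [z] := hdist_ex x h0; rewrite /hsub hopp0 haddr0 => -> ->; by [].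
Qed.

Lemma hdist_ge0 x y : 0 <= hdist x y.
Proof. by have [z _ ->] := hdist_ex x y; exact: habs_ge0. Qed.

Lemma hdist_eq0 x y : hdist x y = 0 -> x = y.
Proof.
by have [z hz ->] := hdist_ex x y => /habs_eq0 z0; apply: hsub_eq0; rewrite -z0.
Qed.

Lemma hdist_ultra x y z : hdist x z <= Num.max (hdist x y) (hdist y z).
Proof.
have [a ha ->] := hdist_ex x y; have [b hb ->] := hdist_ex y z.
have {ha} xa : hadd a y x by rewrite haddC; move: ha; rewrite /hsub => /hadd_rev; rewrite haddC.
have {hb} yb : hadd b z y by move/hadd_rev : hb.
have [u hu hx] : exists2 u, hadd a b u & hadd u z x by apply/haddAP; exists y.
apply: (@le_trans _ _ (habs u)); last exact: habsD.
by apply: hdist_le; apply/hadd_rev.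
Qed.

Lemma hdistMr x y z : hdist (hmul x z) (hmul y z) = hdist x y * habs z.
Proof.
have [->|z0] := eqVneq z h0.
  by rewrite ![hmul _ h0]hmulC !hmul0 hdistxx habs0 mulr0.
have [->|xy] := eqVneq x y; first by rewrite !hdistxx mul0r.
have [u hu ->] := hdist_ex x y.
rewrite -habsM; apply: hdistE; last first.
  by rewrite /hsub -hmulNr; exact: hmul_Dl.
have [w zw] := hmul_inv _ z0; apply: contra_neq xy => /(congr1 (hmul^~ w)).
by rewrite -!hmulA zw !hmul1r.
Qed.

Lemma hdistMl x y z : hdist (hmul z x) (hmul z y) = habs z * hdist x y.
Proof. by rewrite ![hmul z _]hmulC hdistMr mulrC. Qed.

Lemma habs_hdist x y : habs x <= Num.max (habs y) (hdist x y).
Proof.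
by rewrite -!(hdist0) maxC; exact: hdist_ultra.
Qed.

Lemma habs_inv x y : hmul x y = h1 -> habs y = (habs x)^-1.
Proof.
move=> xy; apply: (mulfI (x := habs x)); last rewrite -habsM xy habs1 mulfV//.
  by rewrite gt_eqF// habs_gt0; apply/eqP => x0; move: xy; rewrite x0 hmul0 => /eqP; rewrite (negbTE h0_neq1).
by rewrite gt_eqF// habs_gt0; apply/eqP => x0; move: xy; rewrite x0 hmul0 => /eqP; rewrite (negbTE h0_neq1).
Qed.

Lemma hmulV x : x != h0 -> hmul x (hinv x) = h1.
Proof. by move=> /hmul_inv h; apply: (xgetPex h0 h). Qed.

Lemma habsV x : x != h0 -> habs (hinv x) = (habs x)^-1.
Proof. by move/hmulV/habs_inv. Qed.

Lemma habsX x n : habs (hexp x n) = habs x ^+ n.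
Proof. by elim: n => [|n IH] /=; rewrite ?habs1// habsM IH exprS. Qed.

Lemma hexp_neq0 x n : x != h0 -> hexp x n != h0.
Proof. by rewrite -!habs_gt0 habsX; exact: exprn_gt0. Qed.

Lemma habsXz x (i : int) : x != h0 -> habs (hexpz x i) = habs x ^ i.
Proof.
move=> x0; case: i => n; first exact: habsX.
by rewrite [hexpz _ _]/(hinv (hexp x n.+1)) habsV ?hexp_neq0// habsX NegzE exprnN.
Qed.

Lemma cball_center x y r : cball x r y -> cball x r = cball y r.
Proof.
move=> xy; apply/seteqP; split=> z /= h.
  by apply: le_trans (hdist_ultra y x z) _; rewrite ge_max hdist_sym h (xy : _ <= r).
by apply: le_trans (hdist_ultra x y z) _; rewrite ge_max h (xy : _ <= r).
Qed.

Lemma oball_center x y r : oball x r y -> oball x r = oball y r.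
Proof.
move=> xy; apply/seteqP; split=> z /= h.
  by apply: le_lt_trans (hdist_ultra y x z) _; rewrite gt_max hdist_sym h (xy : _ < r).
by apply: le_lt_trans (hdist_ultra x y z) _; rewrite gt_max h (xy : _ < r).
Qed.

End Distance.
Arguments sum_radius {R} H rho.

HB.mixin Record isValuedHyperfield (R : realType) H of NormedHyperfield R H := {
  ex_sum_radius : exists rho : R, sum_radius H rho
}.

#[short(type="valuedHyperfieldType")]
HB.structure Definition ValuedHyperfield (R : realType) :=
  {H of isValuedHyperfield R H & NormedHyperfield R H}.

Section Constants.
Variables (R : realType) (H : valuedHyperfieldType R).

Definition hnorms : set R := range (@habs R H).

Definition discretely_valued := hnorms `\` isolated hnorms = [set 0].

(* A minimum when H is discretely valued; see hrho_spec. *)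
Definition hrho : R := inf [set rho | sum_radius H rho].

(* The set of norms accumulates at 0, so the norm of a uniformizer is the
   largest (not the smallest) norm less than 1. *)
Definition htheta : R := sup [set habs x | x in [set x : H | x != h0 /\ habs x < 1]].

Definition uniformizer (p : H) := habs p = htheta.

Definition mpow (i : int) : set H := cball h0 (htheta ^ i).

End Constants.
Arguments discretely_valued {R} H.
Arguments hrho {R} H.
Arguments htheta {R} H.
Arguments mpow {R} H i.

HB.mixin Record isDiscreteNonField (R : realType) H of ValuedHyperfield R H := {
  discretely_valuedP : discretely_valued H;
  not_is_field : ~ is_field H
}.

#[short(type="dvHyperfieldType")]
HB.structure Definition DVHyperfield (R : realType) :=
  {H of isDiscreteNonField R H & ValuedHyperfield R H}.

Section DVHyperfieldTheory.
Variables (R : realType) (H : dvHyperfieldType R).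
Implicit Types (x y z t : H).

Lemma habs_small (e : R) : 0 < e -> exists2 x : H, x != h0 & habs x < e.
Proof.
move=> e0; have [+ _] : (hnorms H `\` isolated (hnorms H)) 0.
  by rewrite (discretely_valuedP (s:=H)).
move=> V0; have [_ ] : (hnorms H `\` isolated (hnorms H)) 0.
  by rewrite (discretely_valuedP (s:=H)).
apply: contra_notP => noex; split; first exact/mem_set.
exists (ball (0:R) e); first exact: nbhsx_ballx.
apply/seteqP; split=> [r [/= + [x _ xr]]|_ ->]; last by split=> //; exact: ballxx.
rewrite -ball_normE /= sub0r normrN -xr ger0_norm ?habs_ge0// => xe.
have [->|x0] := eqVneq x h0; first exact: habs0.
by exfalso; apply: noex; exists x.
Qed.

Lemma habs_gap : exists2 e : R, 0 < e < 1 &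
  forall x y, habs x < habs y -> habs x <= (1 - e) * habs y.
Proof.
have [] : isolated (hnorms H) 1.
  have /seteqP[/(_ 1) + _] := discretely_valuedP (s:=H).
  move=> h; apply: contrapT => niso; have V1 : hnorms H 1 by exists h1 => //; exact: habs1.
  by have /= /eqP := h (conj V1 niso); rewrite oner_eq0.
move=> _ [V V1 VE].
move: V1 => /(@nbhs_ballP R R) [e /= e0 eV].
exists (Num.min e (1 / 2)).
  by rewrite lt_min e0/= divr_gt0//= gt_min orbC ltr_pdivrMr// mul1r ltrDl ltr01.
move=> x y xy.
have y0 : y != h0 by rewrite -habs_gt0; exact: le_lt_trans (habs_ge0 _) xy.
have ay0 : 0 < habs y by rewrite habs_gt0.
rewrite -ler_pdivrMr//.
have -> : habs x / habs y = habs (hmul x (hinv y)) by rewrite habsM habsV.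
have lt1 : habs (hmul x (hinv y)) < 1 by rewrite habsM habsV// ltr_pdivrMr// mul1r.
rewrite leNgt; apply/negP => gt1.
suff : [set (1:R)] (habs (hmul x (hinv y))) by move=> /= e1; rewrite e1 ltxx in lt1.
rewrite -VE; split; last by exists (hmul x (hinv y)).
apply: eV; rewrite -ball_normE /= gtr0_norm ?subr_gt0//.
rewrite ltrBlDr -ltrBlDl; apply: le_lt_trans gt1.
by rewrite lerD2l lerN2 ge_min lexx.
Qed.

Lemma htheta_spec : exists p : H, [/\ p != h0, habs p < 1 & uniformizer p].
Proof.
rewrite /uniformizer /htheta.
set S := (X in sup X).
have [x0 x0n x01] := habs_small (@ltr01 R).
have S0 : S !=set0 by exists (habs x0), x0.
have Sub : has_ubound S by exists 1 => _ [x [_ /ltW x1]] <-.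
have [e /andP[e0 e1] gap] := habs_gap.
have sup0 : 0 < sup S.
  by apply: lt_le_trans (ub_le_sup Sub _); last (by exists x0); rewrite habs_gt0.
have [|_ [x [xn x1] <-] sx] := @sup_adherent R S (sup S * e) _ (conj S0 Sub).
  by rewrite mulr_gt0.
exists x; split=> //; apply/eqP; rewrite eq_le; apply/andP; split.
  by apply: ub_le_sup => //; exists x.
apply: ge_sup => // _ [y [yn y1] <-]; rewrite leNgt; apply/negP => /gap.
apply/negP; rewrite -ltNge; apply: le_lt_trans sx.
have -> : sup S - sup S * e = (1 - e) * sup S by rewrite mulrBl mul1r mulrC.
rewrite ler_wpM2l ?subr_ge0 ?(ltW e1)//.
by apply: (ub_le_sup Sub); exists y.
Qed.

Lemma uniformizer_neq0 (p : H) : uniformizer p -> p != h0.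
Proof.
move=> up; have [q [q0 _ uq]] := htheta_spec.
by rewrite -habs_gt0 (up : _ = _) -(uq : _ = _) habs_gt0.
Qed.

Lemma ex_uniformizer : exists p : H, uniformizer p.
Proof. by have [p [_ _ up]] := htheta_spec; exists p. Qed.

Lemma htheta_gt0 : 0 < htheta H.
Proof. by have [p [p0 _ <-]] := htheta_spec; rewrite habs_gt0. Qed.

Lemma htheta_lt1 : htheta H < 1.
Proof. by have [p [_ p1 <-]] := htheta_spec. Qed.

Lemma htheta_max x : habs x < 1 -> habs x <= htheta H.
Proof.
move=> x1; have [->|x0] := eqVneq x h0; first by rewrite habs0 ltW// htheta_gt0.
apply: ub_le_sup; last by exists x.
by exists 1 => _ [y [_ /ltW y1]] <-.
Qed.

Lemma hthetaXz_gt0 (i : int) : 0 < htheta H ^ i.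
Proof. exact/exprz_gt0/htheta_gt0. Qed.

Lemma habs_unifXz (p : H) (i : int) : uniformizer p -> habs (hexpz p i) = htheta H ^ i.
Proof. by move=> up; rewrite habsXz ?uniformizer_neq0// (up : _ = _). Qed.

Lemma habs_thetaX x : x != h0 -> habs x <= 1 -> exists n : nat, habs x = htheta H ^+ n.
Proof.
move=> x0 x1.
have exn : exists n, htheta H ^+ n.+1 < habs x.
  have : ((htheta H) ^+ n @[n --> \oo] --> (0 : R))%classic.
    by apply: cvg_expr; rewrite gtr0_norm ?htheta_gt0 ?htheta_lt1.
  move/cvgrPdist_lt => /(_ (habs x)); rewrite habs_gt0 => /(_ x0) [N _ hN].
  exists N; have := hN N.+1 (leqnSn N).
  by rewrite /= sub0r normrN gtr0_norm// exprn_gt0// htheta_gt0.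
case: (ex_minnP exn) => n hn nmin; exists n.
have le_n : habs x <= htheta H ^+ n.
  case: n hn nmin => [|n] _ nmin; first by rewrite expr0.
  by rewrite leNgt; apply/negP => /nmin; rewrite ltnn.
have [p up] := ex_uniformizer.
have pn0 : hexp p n != h0 by rewrite hexp_neq0// uniformizer_neq0.
have an : habs (hexp p n) = htheta H ^+ n by rewrite habsX (up : _ = _).
apply/eqP; rewrite eq_le le_n/= leNgt; apply/negP => lt_n.
have := @htheta_max (hmul x (hinv (hexp p n))).
rewrite habsM habsV// an ltr_pdivrMr ?exprn_gt0 ?htheta_gt0// mul1r => /(_ lt_n).
by rewrite ler_pdivrMr ?exprn_gt0 ?htheta_gt0// -exprS leNgt hn.
Qed.

Lemma habs_thetaXz x : x != h0 -> exists i : int, habs x = htheta H ^ i.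
Proof.
move=> x0; have [|x1] := leP (habs x) 1.
  by move=> /(habs_thetaX x0)[n xn]; exists n%:Z.
have i0 : hinv x != h0 by rewrite -habs_gt0 habsV// invr_gt0 habs_gt0.
have [|n] := habs_thetaX i0; first by rewrite habsV// invf_le1 ?habs_gt0// ltW.
rewrite habsV// => xn; exists (- n%:Z).
by rewrite -exprnN -xn invrK.
Qed.

Lemma habs_lt_theta x (i : int) : habs x < htheta H ^ i -> habs x <= htheta H ^ (i + 1).
Proof.
have [p up] := ex_uniformizer => xi.
have pi0 : hexpz p i != h0 by rewrite -habs_gt0 habs_unifXz// hthetaXz_gt0.
have := @htheta_max (hmul x (hinv (hexpz p i))).
rewrite habsM habsV// habs_unifXz// ltr_pdivrMr ?hthetaXz_gt0// mul1r => /(_ xi).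
by rewrite ler_pdivrMr ?hthetaXz_gt0// exprzDr ?unitfE ?gt_eqF ?htheta_gt0// expr1z mulrC.
Qed.

Lemma hrho_spec : [/\ sum_radius H (hrho H),
  (forall rho, sum_radius H rho -> hrho H <= rho),
  (forall x y, is_cball (hrho H * Num.max (habs x) (habs y)) (hadd x y)) &
  exists2 v : H, v != h0 & habs v = hrho H].
Proof.
have [rho [rho0 hrho_]] := ex_sum_radius (s:=H).
have B0 : hsub (h1:H) h1 h0 by exact: hsubrr.
have m1 : Num.max (habs (h1:H)) (habs (hopp h1:H)) = 1 by rewrite habsN habs1 maxxx.
have rBc (r : R) : (forall x y, is_cball (r * Num.max (habs x) (habs y)) (hadd x y)) ->
    hsub (h1:H) h1 = [set z | habs z <= r].
  move=> /(_ h1 (hopp h1)); rewrite m1 mulr1 => -[c hc].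
  rewrite /hsub hc (@cball_center _ _ c h0); last by rewrite -hc.
  by apply/seteqP; split=> z; rewrite /cball/= hdist_sym hdist0.
have rBo (r : R) : (forall x y, ~~ ((x == h0) && (y == h0)) ->
      is_oball (r * Num.max (habs x) (habs y)) (hadd x y)) ->
    hsub (h1:H) h1 = [set z | habs z < r].
  move=> /(_ h1 (hopp h1)); rewrite m1 mulr1.
  rewrite eq_sym (negbTE (h0_neq1 (s:=H)))/= => /(_ isT) [c hc].
  rewrite /hsub hc (@oball_center _ _ c h0); last by rewrite -hc.
  by apply/seteqP; split=> z; rewrite /oball/= hdist_sym hdist0.
have rB (r : R) : sum_radius H r ->
    hsub (h1:H) h1 = [set z | habs z <= r] \/ hsub (h1:H) h1 = [set z | habs z < r].
  by case=> _ [/rBc|/rBo]; [left|right].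
have [v [vB v0 vmax]] : exists v : H, [/\ hsub h1 h1 v, v != h0 &
    forall z, hsub h1 h1 z -> habs z <= habs v].
  have [w w0 wr] := habs_small rho0.
  have wB : hsub h1 h1 w.
    by case: (rB _ (conj rho0 hrho_)) => -> //=; exact: ltW.
  have [i wi] := habs_thetaXz w0.
  have bnd z : hsub (h1:H) h1 z -> habs z <= 1.
    by move=> /habsD; rewrite habsN habs1 maxxx.
  have [p up] := ex_uniformizer.
  have [//|k wk] := @habs_thetaX w w0; first exact: bnd.
  have exk : exists k : nat, `[< hsub (h1:H) h1 (hexp p k) >].
    exists k; apply/asboolP.
    have e : habs (hexp p k) = habs w by rewrite habsX (up : _ = _).
    by case: (rB _ (conj rho0 hrho_)) wB => -> /=; rewrite e.
  case: (ex_minnP exk) => n /asboolP nB nmin; exists (hexp p n); split=> //.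
    by rewrite hexp_neq0// uniformizer_neq0.
  move=> z zB; have [->|z0] := eqVneq z h0; first by rewrite habs0 habs_ge0.
  have [m zm] := habs_thetaX z0 (bnd _ zB).
  have e : habs (hexp p m) = habs z by rewrite habsX (up : _ = _).
  rewrite habsX (up : _ = _) zm ler_wiXn2l ?ltW ?htheta_gt0 ?htheta_lt1//.
  apply: nmin; apply/asboolP.
  by case: (rB _ (conj rho0 hrho_)) zB => -> /=; rewrite e.
have Bv r : sum_radius H r -> hsub (h1:H) h1 = [set z | habs z <= habs v].
  move=> hr; apply/seteqP; split=> z; first exact: vmax.
  by case: (rB _ hr) vB => -> /=; [move=> a b; exact: le_trans b a|move=> a b; exact: le_lt_trans b a].
have vlb r : sum_radius H r -> habs v <= r.
  by move=> hr; case: (rB _ hr) vB => -> //= /ltW.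
have vsum x y : is_cball (habs v * Num.max (habs x) (habs y)) (hadd x y).
  have [/andP[/eqP-> /eqP->]|xy0] := boolP ((x == h0) && (y == h0)).
    rewrite haddr0 habs0 maxxx mulr0; exists h0; apply/seteqP; split=> z; rewrite /cball/=.
      by move->; rewrite hdistxx.
    by rewrite hdist_sym hdist0 => z0; apply/habs_eq0/eqP; rewrite eq_le z0 habs_ge0.
  have [u u0 um] : exists2 u : H, u != h0 & Num.max (habs x) (habs y) = habs u.
    have [xy|xy] := leP (habs x) (habs y); [exists y|exists x] => //.
      apply: contraNneq xy0 => y0; move: xy; rewrite y0 habs0 => xy.
      by rewrite eqxx andbT; apply/eqP/habs_eq0/eqP; rewrite eq_le habs_ge0 xy.
    by rewrite -habs_gt0; exact: le_lt_trans (habs_ge0 _) xy.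
  have au0 : 0 < habs u by rewrite habs_gt0.
  have keyv w : hsub (h1:H) h1 (hmul w (hinv u)) <-> habs w <= habs v * habs u.
    by rewrite (Bv rho (conj rho0 hrho_))/= habsM habsV// ler_pdivrMr.
  case: (hrho_) => hr.
    have [c cE] := hr x y; have [d dxy] := hadd_nonempty x y.
    exists d; rewrite cE um; move: (dxy); rewrite cE um => /cball_center ->.
    have keyr w : hsub (h1:H) h1 (hmul w (hinv u)) <-> habs w <= rho * habs u.
      by rewrite (rBc _ hr)/= habsM habsV// ler_pdivrMr.
    apply/seteqP; split=> z; rewrite /cball/=; have [t _ ->] := hdist_ex d z.
      by move/keyr/keyv.
    by move/keyv/keyr.
  have [c cE] := hr x y xy0; have [d dxy] := hadd_nonempty x y.
  exists d; rewrite cE um; move: (dxy); rewrite cE um => /oball_center ->.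
  have keyr w : hsub (h1:H) h1 (hmul w (hinv u)) <-> habs w < rho * habs u.
    by rewrite (rBo _ hr)/= habsM habsV// ltr_pdivrMr.
  apply/seteqP; split=> z; rewrite /cball /oball/=; have [t _ ->] := hdist_ex d z.
    by move/keyr/keyv.
  by move/keyv/keyr.
have vrad : sum_radius H (habs v) by split; [rewrite habs_gt0|left].
have -> : hrho H = habs v.
  apply/eqP; rewrite eq_le; apply/andP; split.
    by apply: ge_inf => //; exists (habs v) => r /vlb.
  by apply: lb_le_inf; [exists (habs v)|move=> r /vlb].
split=> //; by exists v.
Qed.
End DVHyperfieldTheory.

Section TruncatedDVR.
Variable A : comNzRingType.
Implicit Types (I m : set A).

Definition is_ideal I := [/\ I 0, forall x y, I x -> I y -> I (x + y) &
  forall a x, I x -> I (a * x)].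

Definition is_maximal_ideal m := [/\ is_ideal m, ~ m 1 &
  forall I, is_ideal I -> ~ I 1 -> m `<=` I -> I = m].

Definition is_local := exists! m, is_maximal_ideal m.

Definition is_artinian := forall I : nat -> set A, (forall n, is_ideal (I n)) ->
  (forall n, I n.+1 `<=` I n) -> exists N, forall n, (N <= n)%N -> I n = I N.

Definition is_principal I := exists g, I = range (fun a => a * g).

Definition truncated_dvr := [/\ is_local, is_artinian &
  forall m, is_maximal_ideal m -> is_principal m].

End TruncatedDVR.
Arguments is_local : clear implicits.
Arguments is_artinian : clear implicits.
Arguments truncated_dvr : clear implicits.

Section Tensor.
Variables (A : comNzRingType) (M N : lmodType A).
Implicit Types (s t u : seq (M * N)).

(* A sequence of pairs stands for a formal sum of pure tensors. *)
Inductive tensor_eqv : seq (M * N) -> seq (M * N) -> Prop :=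
| teqv_refl s : tensor_eqv s s
| teqv_sym s t : tensor_eqv s t -> tensor_eqv t s
| teqv_trans s t u : tensor_eqv s t -> tensor_eqv t u -> tensor_eqv s u
| teqv_cat s s' t t' : tensor_eqv s s' -> tensor_eqv t t' ->
    tensor_eqv (s ++ t) (s' ++ t')
| teqv_catC s t : tensor_eqv (s ++ t) (t ++ s)
| teqv_zero y : tensor_eqv [:: (0, y)] [::]
| teqv_addl x x' y : tensor_eqv [:: (x + x', y)] [:: (x, y); (x', y)]
| teqv_addr x y y' : tensor_eqv [:: (x, y + y')] [:: (x, y); (x, y')]
| teqv_scale a x y : tensor_eqv [:: (a *: x, y)] [:: (x, a *: y)].

Definition tensor_eqb s t := `[< tensor_eqv s t >].

Fact tensor_eqb_refl : reflexive tensor_eqb.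
Proof. by move=> s; apply/asboolP; exact: teqv_refl. Qed.

Fact tensor_eqb_sym : symmetric tensor_eqb.
Proof. by move=> s t; apply/asboolP/asboolP; exact: teqv_sym. Qed.

Fact tensor_eqb_trans : transitive tensor_eqb.
Proof.
by move=> t s u /asboolP st /asboolP tu; apply/asboolP; exact: teqv_trans tu.
Qed.

Canonical tensor_equiv :=
  EquivRel tensor_eqb tensor_eqb_refl tensor_eqb_sym tensor_eqb_trans.

Definition tensor : Type := {eq_quot tensor_equiv}.
HB.instance Definition _ := Choice.on tensor.

Definition tensor_class s : tensor := \pi_({eq_quot tensor_equiv}) s.
Definition tensor_repr (t : tensor) : seq (M * N) :=
  repr (t : {eq_quot tensor_equiv}).

Definition ptens (x : M) (y : N) : tensor := tensor_class [:: (x, y)].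

Lemma tensor_reprK (t : tensor) : tensor_class (tensor_repr t) = t.
Proof. exact: reprK. Qed.

Lemma tensor_classP s t : tensor_class s = tensor_class t <-> tensor_eqv s t.
Proof. by split=> [/eqmodP/asboolP|h] //; apply/eqmodP/asboolP. Qed.

Lemma tensor_repr_eqv s : tensor_eqv (tensor_repr (tensor_class s)) s.
Proof. by apply/tensor_classP; rewrite tensor_reprK. Qed.

Definition scale_seq (a : A) s := [seq (a *: p.1, p.2) | p <- s].

Fact scale_seq_eqv a s t : tensor_eqv s t -> tensor_eqv (scale_seq a s) (scale_seq a t).
Proof.
elim=> {s t}.
- by move=> s; exact: teqv_refl.
- by move=> s t _; exact: teqv_sym.
- by move=> s t u _ st _ tu; exact: teqv_trans tu.
- by move=> s s' t t' _ ? _ ?; rewrite /scale_seq !map_cat; exact: teqv_cat.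
- by move=> s t; rewrite /scale_seq !map_cat; exact: teqv_catC.
- by move=> y; rewrite /scale_seq/= scaler0; exact: teqv_zero.
- by move=> x x' y; rewrite /scale_seq/= scalerDr; exact: teqv_addl.
- by move=> x y y'; exact: teqv_addr.
- by move=> b x y; rewrite /scale_seq/= !scalerA mulrC -scalerA; exact: teqv_scale.
Qed.

Definition tensor_add (t u : tensor) := tensor_class (tensor_repr t ++ tensor_repr u).
Definition tensor_scale (a : A) (t : tensor) := tensor_class (scale_seq a (tensor_repr t)).

Fact tensor_addE s t : tensor_add (tensor_class s) (tensor_class t) = tensor_class (s ++ t).
Proof. by apply/tensor_classP/teqv_cat; exact: tensor_repr_eqv. Qed.

Fact tensor_scaleE a s : tensor_scale a (tensor_class s) = tensor_class (scale_seq a s).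
Proof. by apply/tensor_classP/scale_seq_eqv/tensor_repr_eqv. Qed.

Fact tensor_addA : associative tensor_add.
Proof.
move=> t u v; rewrite -(tensor_reprK t) -(tensor_reprK u) -(tensor_reprK v).
by rewrite !tensor_addE catA.
Qed.

Fact tensor_addC : commutative tensor_add.
Proof. by move=> t u; apply/tensor_classP/teqv_catC. Qed.

Fact tensor_add0 : left_id (tensor_class [::]) tensor_add.
Proof. by move=> t; rewrite -(tensor_reprK t) tensor_addE. Qed.

Fact scale_seqDl a b s :
  tensor_eqv (scale_seq (a + b) s) (scale_seq a s ++ scale_seq b s).
Proof.
elim: s => [|[x y] s IH]; first exact: teqv_refl.
have e1 : tensor_eqv (scale_seq (a + b) ((x, y) :: s))
    ([:: (a *: x, y)] ++ ([:: (b *: x, y)] ++ (scale_seq a s ++ scale_seq b s))).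
  rewrite catA -cat1s /scale_seq/= scalerDl.
  exact: (teqv_cat (s := [:: _]) (s' := [:: _; _])) (teqv_addl _ _ _) IH.
apply: teqv_trans e1 _.
rewrite -[scale_seq a (_ :: _)]cat1s -[scale_seq b (_ :: _)]cat1s -catA.
apply: teqv_cat (teqv_refl _) _; rewrite 2!catA.
exact: teqv_cat (teqv_catC _ _) (teqv_refl _).
Qed.

Fact tensor_scaleDl (t : tensor) : {morph tensor_scale^~ t : a b / a + b >-> tensor_add a b}.
Proof.
move=> a b; rewrite -(tensor_reprK t) !tensor_scaleE tensor_addE.
exact/tensor_classP/scale_seqDl.
Qed.

Fact tensor_scaleDr a : {morph tensor_scale a : t u / tensor_add t u}.
Proof.
move=> t u; rewrite -(tensor_reprK t) -(tensor_reprK u).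
by rewrite !(tensor_addE, tensor_scaleE) /scale_seq map_cat.
Qed.

Fact tensor_scaleA a b (t : tensor) : tensor_scale a (tensor_scale b t) = tensor_scale (a * b) t.
Proof.
rewrite -(tensor_reprK t) !tensor_scaleE /scale_seq -map_comp; congr tensor_class.
by apply: eq_map => p /=; rewrite scalerA.
Qed.

Fact tensor_scale1 : left_id 1 tensor_scale.
Proof.
move=> t; rewrite -(tensor_reprK t) !tensor_scaleE /scale_seq; congr tensor_class.
by rewrite -[RHS]map_id; apply: eq_map => -[x y] /=; rewrite scale1r.
Qed.

Fact tensor_scale0 (t : tensor) : tensor_scale 0 t = tensor_class [::].
Proof.
rewrite -(tensor_reprK t) !tensor_scaleE; apply/tensor_classP.
elim: (tensor_repr t) => [|[x y] s IH]; first exact: teqv_refl.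
rewrite /scale_seq/= scale0r -cat1s.
exact: (teqv_cat (s' := [::])) (teqv_zero _) IH.
Qed.

Fact tensor_addN : left_inverse (tensor_class [::]) (tensor_scale (-1)) tensor_add.
Proof.
move=> t; rewrite -{2}(tensor_scale1 t) -tensor_scaleDl addNr.
exact: tensor_scale0.
Qed.

HB.instance Definition _ := GRing.isZmodule.Build tensor
  tensor_addA tensor_addC tensor_add0 tensor_addN.
HB.instance Definition _ := GRing.Zmodule_isLmodule.Build A tensor
  tensor_scaleA tensor_scale1 tensor_scaleDr tensor_scaleDl.

Lemma tensor_classE s : tensor_class s = \sum_(p <- s) ptens p.1 p.2.
Proof.
elim: s => [|[x y] s IH]; first by rewrite big_nil.
by rewrite big_cons -IH /= /ptens -cat1s -tensor_addE.
Qed.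

Lemma ptensDl y : {morph ptens^~ y : x x' / x + x'}.
Proof.
move=> x x'; rewrite [RHS](tensor_addE [:: _] [:: _]).
exact/tensor_classP/teqv_addl.
Qed.

Lemma ptensDr x : {morph ptens x : y y' / y + y'}.
Proof.
move=> y y'; rewrite [RHS](tensor_addE [:: _] [:: _]).
exact/tensor_classP/teqv_addr.
Qed.

Lemma ptensZl a x y : ptens (a *: x) y = a *: ptens x y.
Proof. by rewrite [RHS]tensor_scaleE. Qed.

Lemma ptensZr a x y : ptens x (a *: y) = a *: ptens x y.
Proof. by rewrite -ptensZl; apply/esym/tensor_classP/teqv_scale. Qed.

Lemma tensor_ind (P : tensor -> Prop) : P 0 -> (forall x y, P (ptens x y)) ->
  (forall t u : tensor, P t -> P u -> P (t + u)) -> forall t : tensor, P t.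
Proof.
move=> P0 P1 P2 t; rewrite -(tensor_reprK t) tensor_classE.
elim: (tensor_repr t) => [|p s IH]; first by rewrite big_nil.
by rewrite big_cons; apply: P2.
Qed.

Definition bilinear_map (P : lmodType A) (b : M -> N -> P) :=
  (forall y, linear (b^~ y)) /\ (forall x, linear (b x)).

Definition tensor_lift (P : lmodType A) (b : M -> N -> P) (t : tensor) : P :=
  \sum_(p <- tensor_repr t) b p.1 p.2.

Section Lift.
Variables (P : lmodType A) (b : M -> N -> P).
Hypothesis bil : bilinear_map b.

Fact tensor_lift_eqv s t : tensor_eqv s t ->
  \sum_(p <- s) b p.1 p.2 = \sum_(p <- t) b p.1 p.2.
Proof.
have [bl br] := bil.
have bDl y x x' : b (x + x') y = b x y + b x' y by have := bl y 1 x x'; rewrite !scale1r.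
have bDr x y y' : b x (y + y') = b x y + b x y' by have := br x 1 y y'; rewrite !scale1r.
have b0l y : b 0 y = 0 by apply: (addIr (b 0 y)); rewrite -bDl !add0r.
have b0r x : b x 0 = 0 by apply: (addIr (b x 0)); rewrite -bDr !add0r.
elim=> {s t}.
- by [].
- by move=> s t _ ->.
- by move=> s t u _ -> _ ->.
- by move=> s s' t t' _ e _ e'; rewrite !big_cat/= e e'.
- by move=> s t; rewrite !big_cat/= addrC.
- by move=> y; rewrite big_seq1 big_nil /= b0l.
- by move=> x x' y; rewrite big_seq1 big_cons big_seq1 /= bDl.
- by move=> x y y'; rewrite big_seq1 big_cons big_seq1 /= bDr.
- move=> a x y; rewrite !big_seq1 /=.
  have := bl y a x 0; have := br x a y 0.
  by rewrite !addr0 b0l b0r !addr0 => -> ->.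
Qed.

Lemma tensor_lift_class s : tensor_lift b (tensor_class s) = \sum_(p <- s) b p.1 p.2.
Proof. exact/tensor_lift_eqv/tensor_repr_eqv. Qed.

Lemma tensor_lift_ptens x y : tensor_lift b (ptens x y) = b x y.
Proof. by rewrite tensor_lift_class big_seq1. Qed.

Lemma tensor_lift_linear : linear (tensor_lift b).
Proof.
move=> a t u; rewrite -(tensor_reprK t) -(tensor_reprK u).
rewrite [a *: _]tensor_scaleE [_ + _ in LHS]tensor_addE !tensor_lift_class.
rewrite big_cat /= big_map /= scaler_sumr; congr (_ + _).
apply: eq_bigr => p _; have [bl _] := bil.
have b0 : b 0 p.2 = 0.
  by apply: (addIr (b 0 p.2)); have := bl p.2 1 0 0; rewrite !scale1r !addr0 add0r.
by have := bl p.2 a p.1 0; rewrite b0 !addr0.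
Qed.

End Lift.
End Tensor.

Lemma add_self_eq0 (V : zmodType) (v : V) : v = v + v -> v = 0.
Proof. by move/eqP; rewrite -{1}[v]addr0 (inj_eq (addrI v)) eq_sym => /eqP. Qed.

Section Rank1.
Variables (A : comNzRingType) (M : lmodType A).
Implicit Types (x y : M).

Definition is_generator x := forall y, exists! a : A, y = a *: x.

Definition free_rank1 := exists x, is_generator x.

Definition coord1 x y : A := xget 0 [set a : A | y = a *: x].

Section Coord.
Variable x : M.
Hypothesis gx : is_generator x.

Lemma coord1K y : y = coord1 x y *: x.
Proof. by have [a [ya _]] := gx y; exact: (xgetI 0 (ya : [set a | y = a *: x] a)). Qed.

Lemma generator_inj a b : a *: x = b *: x -> a = b.
Proof. by have [c [_ h]] := gx (b *: x) => e; rewrite -(h a)// -(h b). Qed.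

Lemma coord1Z a : coord1 x (a *: x) = a.
Proof. by apply: generator_inj; rewrite -coord1K. Qed.

Lemma coord1_linear : linear (coord1 x : M -> A^o).
Proof.
move=> a y z; apply: generator_inj; rewrite -coord1K [in LHS](coord1K y) [in LHS](coord1K z).
by rewrite scalerA -scalerDl.
Qed.

End Coord.
End Rank1.
Arguments free_rank1 {A} M.

Section Dual.
Variables (A : comNzRingType) (M : lmodType A).

Definition linear_form : {pred M -> A^o} := fun phi => `[< linear phi >].

Fact linear_form_submod_closed : submod_closed linear_form.
Proof.
split=> [|a phi psi /asboolP phiL /asboolP psiL]; apply/asboolP => b x y.
  by rewrite [RHS]addr0 [RHS]scaler0.
have gen (p q r s : A) : a * (b * p + q) + (b * r + s) = b * (a * p + r) + (a * q + s).
  by rewrite !mulrDr !mulrA addrACA [b * a]mulrC.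
by rewrite [LHS]/(a *: phi (b *: x + y) + psi (b *: x + y)) phiL psiL; exact: gen.
Qed.
HB.instance Definition _ :=
  GRing.isSubmodClosed.Build A (M -> A^o) linear_form linear_form_submod_closed.

Definition dual : Type := {phi : M -> A^o | linear_form phi}.
HB.instance Definition _ := SubChoice.on dual.
HB.instance Definition _ := [SubChoice_isSubLmodule of dual by <:].

(* The basis of the dual of a free module of rank 1 dual to the generator x. *)
Definition dual_generator (x : M) : dual := insubd 0 (coord1 x : M -> A^o).

Lemma dual_generatorE x y : is_generator x -> val (dual_generator x) y = coord1 x y.
Proof. by move=> gx; rewrite insubdK//; apply/asboolP/coord1_linear. Qed.

Lemma dual_generatorP x : is_generator x -> is_generator (dual_generator x).
Proof.
move=> gx phi.
have phiL : linear (val phi) by apply/asboolP/(valP phi).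
have phiE y : val phi y = coord1 x y * val phi x.
  have := phiL (coord1 x y) x 0; rewrite addr0 -coord1K// => ->.
  have -> : val phi 0 = 0.
    by apply: add_self_eq0; have := phiL 1 0 0; rewrite !scale1r !addr0.
  by rewrite addr0.
exists (val phi x); split=> [|a ->].
  apply: val_inj; apply/funext => y; rewrite phiE.
  by rewrite [RHS]/(val phi x *: val (dual_generator x) y) dual_generatorE// mulrC.
rewrite [LHS]/(a *: val (dual_generator x) x) dual_generatorE//.
by rewrite -[X in coord1 x X]scale1r coord1Z// [LHS]mulr1.
Qed.

End Dual.

Section TensorPower.
Variable A : comNzRingType.

Fixpoint tpow_nat (M : lmodType A) (n : nat) : lmodType A :=
  if n is n'.+1 then tensor M (tpow_nat M n') else A^o.

(* Negative tensor powers are tensor powers of the dual. *)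
Definition tpow (M : lmodType A) (i : int) : lmodType A :=
  match i with
  | Posz n => tpow_nat M n
  | Negz n => tpow_nat (dual M) n.+1
  end.

Fixpoint tpure_nat (M : lmodType A) (x : M) (n : nat) : tpow_nat M n :=
  if n is n'.+1 then ptens x (tpure_nat x n') else 1.

Definition tpure (M : lmodType A) (x : M) (i : int) : tpow M i :=
  match i with
  | Posz n => tpure_nat x n
  | Negz n => tpure_nat (dual_generator x) n.+1
  end.

Lemma ptens_generator (M N : lmodType A) (x : M) (y : N) :
  is_generator x -> is_generator y -> is_generator (ptens x y).
Proof.
move=> gx gy.
pose b (u : M) (v : N) : A^o := coord1 x u * coord1 y v.
have bil : bilinear_map b.
  split=> [v|u] a s t; rewrite /b coord1_linear//.
    by rewrite mulrDl -mulrA.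
  by rewrite mulrDr mulrCA.
have ex t : exists a : A, t = a *: ptens x y.
  elim/tensor_ind: t => [|u v|t u [a ->] [c ->]].
  - by exists 0; rewrite scale0r.
  - exists (coord1 x u * coord1 y v).
    by rewrite -scalerA -ptensZr -ptensZl -!coord1K.
  - by exists (a + c); rewrite scalerDl.
move=> t; have [a ta] := ex t; exists a; split=> // c.
have liftE d : tensor_lift b (d *: ptens x y) = d.
  rewrite -ptensZl tensor_lift_ptens// /b coord1Z//.
  by rewrite -[X in coord1 y X]scale1r coord1Z// mulr1.
by rewrite ta => /(congr1 (tensor_lift b)); rewrite !liftE.
Qed.

Lemma tpure_nat_generator (M : lmodType A) (x : M) n :
  is_generator x -> is_generator (tpure_nat x n).
Proof.
move=> gx; elim: n => [|n IH] /=; last exact: ptens_generator.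
by move=> a; exists a; split=> [|b ->]; rewrite [_ *: _]mulr1.
Qed.

Lemma tpure_generator (M : lmodType A) (x : M) i :
  is_generator x -> is_generator (tpure x i).
Proof.
move=> gx; case: i => n; first exact: tpure_nat_generator.
exact/tpure_nat_generator/dual_generatorP.
Qed.

Lemma tpure_natZ (M : lmodType A) (x : M) (a : A) n :
  tpure_nat (a *: x) n = a ^+ n *: tpure_nat x n.
Proof.
elim: n => [|n IH] /=; first by rewrite expr0 scale1r.
by rewrite IH ptensZl ptensZr scalerA exprS.
Qed.

Lemma dual_generatorZ (M : lmodType A) (x : M) (u v : A) : u * v = 1 ->
  is_generator x -> is_generator (u *: x) ->
  dual_generator (u *: x) = v *: dual_generator x.
Proof.
move=> uv gx gux; apply: val_inj; apply/funext => y.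
rewrite [RHS]/(v * val (dual_generator x) y) !dual_generatorE//.
apply: (generator_inj gux); rewrite -coord1K// !scalerA mulrAC [v * u]mulrC uv.
by rewrite mul1r -coord1K.
Qed.

(* For r <= s and e linear, the unique R-linear map sending x^(s) to
   e(x)^(s-r) x^(r) for the generators x of M; see tensor_epsP. *)
Definition tensor_eps (M : lmodType A) (e : M -> A) (r s : int) :
    tpow M s -> tpow M r :=
  xget (fun=> 0) [set g : tpow M s -> tpow M r | linear g /\
    forall x, is_generator x -> g (tpure x s) = e x ^+ `|s - r|%N *: tpure x r].

Arguments tensor_eps {M} e r s t.

Lemma tensor_epsP (M : lmodType A) (e : M -> A^o) (r s : int) :
  free_rank1 M -> linear e -> r <= s ->
  linear (tensor_eps e r s) /\ forall x, is_generator x ->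
    tensor_eps e r s (tpure x s) = e x ^+ `|s - r|%N *: tpure x r.
Proof.
move=> [x gx] eL rs; rewrite /tensor_eps.
set P := (X in xget _ X); suff : exists g, P g by move/(xgetPex (fun=> 0)).
have gs := tpure_generator (i := s) gx.
exists (fun t => (coord1 (tpure x s) t * e x ^+ `|s - r|%N) *: tpure x r); split.
  by move=> a t u; rewrite coord1_linear// mulrDl -mulrA scalerDl -scalerA.
move=> y gy.
have [u [yu _]] := gx y; have [v [xv _]] := gy x.
have uv : u * v = 1.
  by apply: (generator_inj gx); rewrite mulrC -scalerA -yu -xv scale1r.
pose U (i : int) := match i with Posz n => u ^+ n | Negz n => v ^+ n.+1 end.
have tU i : tpure y i = U i *: tpure x i.
  subst y; case: i => n /=; first exact: tpure_natZ.
  rewrite (dual_generatorZ uv gx gy) tpure_natZ ptensZl ptensZr scalerA -exprS.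
  by [].
have US i : U (i + 1) = u * U i.
  case: i => [n|[|n]]; rewrite /U /=.
  - by rewrite addn1 exprS.
  - by rewrite expr1 uv.
  - by rewrite subn1/= [in RHS]exprS mulrA uv mul1r.
have Uk k : U (r + k%:Z) = u ^+ k * U r.
  elim: k => [|k IH]; first by rewrite addr0 expr0 mul1r.
  by rewrite -addn1 PoszD addrA US IH mulrA addn1 -exprS.
have ey : e y = u * e x.
  have := eL u x 0; rewrite addr0 -yu => ->.
  have -> : e 0 = 0.
    by apply: add_self_eq0; have := eL 1 0 0; rewrite !scale1r !addr0.
  by rewrite addr0.
rewrite !tU coord1Z// scalerA ey exprMn; congr (_ *: _).
have {1}-> : s = r + `|s - r|%N%:Z by rewrite gez0_abs ?subr_ge0// [RHS]addrC subrK.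
by rewrite Uk mulrAC.
Qed.

End TensorPower.
Arguments tensor_eps {A M} e r s t.

Record triple := Triple {
  triple_ring : comNzRingType;
  triple_mod : lmodType triple_ring;
  triple_eps : {linear triple_mod -> triple_ring^o};
  triple_dvr : truncated_dvr triple_ring;
  triple_free : free_rank1 triple_mod;
  triple_image : is_maximal_ideal (range triple_eps : set triple_ring)
}.

Section RestrictionOfScalars.
Variables (A B : comNzRingType) (N : lmodType B).

Definition restrict_scalars (f : {rmorphism A -> B}) : Type := N.

Variable f : {rmorphism A -> B}.
HB.instance Definition _ := GRing.Zmodule.copy (restrict_scalars f) N.

Definition rscale (a : A) (n : restrict_scalars f) : restrict_scalars f :=
  f a *: (n : N).

Fact rscaleA a b n : rscale a (rscale b n) = rscale (a * b) n.
Proof. by rewrite /rscale scalerA rmorphM. Qed.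
Fact rscale1 : left_id 1 rscale.
Proof. by move=> n; rewrite /rscale rmorph1 scale1r. Qed.
Fact rscaleDr : right_distributive rscale +%R.
Proof. by move=> a m n; rewrite /rscale scalerDr. Qed.
Fact rscaleDl n : {morph rscale^~ n : a b / a + b}.
Proof. by move=> a b; rewrite /rscale rmorphD scalerDl. Qed.

HB.instance Definition _ := GRing.Zmodule_isLmodule.Build A (restrict_scalars f)
  rscaleA rscale1 rscaleDr rscaleDl.

End RestrictionOfScalars.

Section BaseChange.
Variables (A B : comNzRingType) (f : {rmorphism A -> B}).
Variables (M : lmodType A) (N : lmodType B).

Definition base_change_map (eta : M -> N) :
    tensor M (restrict_scalars B^o f) -> restrict_scalars N f :=
  tensor_lift (fun (x : M) (b : restrict_scalars B^o f) =>
    (b : B) *: eta x : restrict_scalars N f).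

Lemma base_change_bilinear (eta : {linear M -> N | f \; *:%R}) :
  bilinear_map (fun (x : M) (b : restrict_scalars B^o f) =>
    (b : B) *: eta x : restrict_scalars N f).
Proof.
split=> [b|x] a u v.
  rewrite linearP /= scalerDr scalerA mulrC -scalerA; by [].
by rewrite [LHS]scalerDl -scalerA.
Qed.

End BaseChange.

(* epsilon'_(0,r) is only defined for r >= 0. *)
Record triple_hom (T T' : triple) := TripleHom {
  hom_deg : int;
  hom_ring : {rmorphism triple_ring T -> triple_ring T'};
  hom_mod : {linear triple_mod T -> tpow (triple_mod T') hom_deg | hom_ring \; *:%R};
  hom_deg_ge0 : 0 <= hom_deg;
  hom_eps : forall x, hom_ring (triple_eps T x) =
    tensor_eps (triple_eps T') 0 hom_deg (hom_mod x);
  hom_iso : bijective (base_change_map (f := hom_ring) hom_mod)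
}.

Section GradedPieces.
Variables (R : realType) (H : dvHyperfieldType R) (i : int).
Implicit Types x y z : H.

Definition mpow_type : Type := {x : H | x \in mpow H i}.
HB.instance Definition _ := SubChoice.on mpow_type.

Definition mpow_rel (x y : mpow_type) : bool :=
  hdist (val x) (val y) <= hrho H * htheta H ^ i.

Lemma hrho_gt0 : 0 < hrho H.
Proof. by have [[]] := hrho_spec H. Qed.

Lemma hrho_theta_ge0 : 0 <= hrho H * htheta H ^ i.
Proof. by rewrite mulr_ge0 ?ltW ?hrho_gt0 ?hthetaXz_gt0. Qed.

Fact mpow_rel_refl : reflexive mpow_rel.
Proof. by move=> x; rewrite /mpow_rel hdistxx hrho_theta_ge0. Qed.

Fact mpow_rel_sym : symmetric mpow_rel.
Proof. by move=> x y; rewrite /mpow_rel hdist_sym. Qed.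

Fact mpow_rel_trans : transitive mpow_rel.
Proof.
move=> y x z xy yz; apply: le_trans (hdist_ultra _ (val y) _) _.
by rewrite ge_max; apply/andP.
Qed.

Canonical mpow_equiv := EquivRel mpow_rel mpow_rel_refl mpow_rel_sym mpow_rel_trans.

(* The quotient M_i of m_H^i *)
Definition gr : Type := {eq_quot mpow_equiv}.
HB.instance Definition _ := Choice.on gr.

Lemma mpowE x : mpow H i x <-> habs x <= htheta H ^ i.
Proof. by rewrite /mpow /cball /= hdist_sym hdist0. Qed.

Lemma mpow0 : mpow H i h0.
Proof. by apply/mpowE; rewrite habs0 ltW// hthetaXz_gt0. Qed.

Definition mpow_zero : mpow_type := exist _ h0 (mem_set mpow0).

(* The class in M_i of an element of m_H^i (and 0 for the other elements). *)
Definition gcls x : gr := \pi_({eq_quot mpow_equiv}) (insubd mpow_zero x).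

Definition grep (a : gr) : H := val (repr (a : {eq_quot mpow_equiv})).

Lemma grepP a : mpow H i (grep a).
Proof. exact: set_mem (valP (repr (a : {eq_quot mpow_equiv}))). Qed.

Lemma grepK : cancel grep gcls.
Proof. by move=> a; rewrite /gcls /grep valKd reprK. Qed.

Lemma gcls_eq x y : mpow H i x -> mpow H i y ->
  gcls x = gcls y <-> hdist x y <= hrho H * htheta H ^ i.
Proof.
move=> /mem_set hx /mem_set hy; rewrite /gcls; split.
  by move=> /eqmodP; rewrite /= /mpow_rel !insubdK.
by move=> h; apply/eqmodP; rewrite /= /mpow_rel !insubdK.
Qed.

Lemma grep_near x : mpow H i x -> hdist (grep (gcls x)) x <= hrho H * htheta H ^ i.
Proof. by move=> hx; apply/gcls_eq => //; [exact: grepP|rewrite grepK]. Qed.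

Lemma mpow_add x y z : mpow H i x -> mpow H i y -> hadd x y z -> mpow H i z.
Proof.
move=> /mpowE hx /mpowE hy /habsD hz; apply/mpowE; apply: le_trans hz _.
by rewrite ge_max hx.
Qed.

Lemma mpow_opp x : mpow H i x -> mpow H i (hopp x).
Proof. by move=> /mpowE hx; apply/mpowE; rewrite habsN. Qed.

(* The sum of the classes of x and y is the class of any element of x + y. *)
Definition gadd (a b : gr) : gr := gcls (xget h0 (hadd (grep a) (grep b))).
Definition gopp (a : gr) : gr := gcls (hopp (grep a)).

Lemma hadd_diam x y z t : mpow H i x -> mpow H i y -> hadd x y z -> hadd x y t ->
  hdist z t <= hrho H * htheta H ^ i.
Proof.
move=> /mpowE hx /mpowE hy; have [_ _ /(_ x y)[c cE] _] := hrho_spec H.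
move: (cE) => /seteqP[+ _] => sub hz ht.
have zc := sub _ hz; have tc := sub _ ht.
apply: le_trans (hdist_ultra _ c _) _; rewrite ge_max hdist_sym.
apply/andP; split; [apply: le_trans zc _|apply: le_trans tc _];
by rewrite ler_wpM2l ?(ltW hrho_gt0)// ge_max hx.
Qed.

Lemma gcls_addl x x' y z z' : mpow H i x -> mpow H i x' -> mpow H i y ->
  gcls x = gcls x' -> hadd x y z -> hadd x' y z' -> gcls z = gcls z'.
Proof.
move=> hx hx' hy /gcls_eq => /(_ hx hx') xx' hz hz'.
have [w xw wx] := hdist_ex x x'.
have [t ht zt] : exists2 t, hadd x' y t & hadd w t z.
  by apply/haddAP; exists x => //; move/hadd_rev: xw.
apply/gcls_eq; [exact: mpow_add hz|exact: mpow_add hz'|].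
apply: le_trans (hdist_ultra _ t _) _; rewrite ge_max (hadd_diam hx' hy ht hz') andbT.
by rewrite haddC in zt; apply: le_trans (hdist_addl zt) _; rewrite -wx.
Qed.

Lemma gcls_add x y z : mpow H i x -> mpow H i y -> hadd x y z ->
  gadd (gcls x) (gcls y) = gcls z.
Proof.
move=> hx hy hz; rewrite /gadd.
set x' := grep _; set y' := grep _.
have hx' : mpow H i x' by exact: grepP.
have hy' : mpow H i y' by exact: grepP.
have ht := xgetPex h0 (hadd_nonempty x' y'); set t := xget _ _ in ht *.
have [u hu] := hadd_nonempty x' y.
transitivity (gcls u); last by apply: (@gcls_addl x' x y) => //; rewrite grepK.
rewrite haddC in hu; rewrite haddC in ht.
by apply: (@gcls_addl y' y x') => //; rewrite grepK.
Qed.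

Lemma gcls_opp x : mpow H i x -> gopp (gcls x) = gcls (hopp x).
Proof.
move=> hx; apply/gcls_eq; [exact/mpow_opp/grepP|exact: mpow_opp|].
have := grep_near hx; have [z hz ->] := hdist_ex (grep (gcls x)) x.
by apply: le_trans; rewrite -(habsN z); apply/hdist_le/hopp_add.
Qed.

Lemma grW (P : gr -> Prop) : (forall x, mpow H i x -> P (gcls x)) -> forall a, P a.
Proof. by move=> h a; rewrite -(grepK a); exact/h/grepP. Qed.

Fact gaddA : associative gadd.
Proof.
elim/grW=> x hx; elim/grW=> y hy; elim/grW=> z hz.
have [u hu] := hadd_nonempty y z; have [t ht] := hadd_nonempty x u.
have [v hv tv] : exists2 v, hadd x y v & hadd v z t by apply/haddAP; exists u.
have mu := mpow_add hy hz hu; have mv := mpow_add hx hy hv.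
by rewrite (gcls_add hy hz hu) (gcls_add hx mu ht) (gcls_add hx hy hv) (gcls_add mv hz tv).
Qed.

Fact gaddC : commutative gadd.
Proof. by move=> a b; rewrite /gadd haddC. Qed.

Fact gadd0 : left_id (gcls h0) gadd.
Proof. by elim/grW=> x hx; apply: gcls_add => //; [exact: mpow0|rewrite hadd0r]. Qed.

Fact gaddN : left_inverse (gcls h0) gopp gadd.
Proof.
elim/grW=> x hx; rewrite gcls_opp//; apply: gcls_add => //; first exact: mpow_opp.
by rewrite haddC; exact: hsubrr.
Qed.

HB.instance Definition _ := GRing.isZmodule.Build gr gaddA gaddC gadd0 gaddN.

End GradedPieces.

Arguments gr {R} H i.
Arguments gcls {R H} i x.
Arguments gadd : simpl never.

Section GradedRing.
Variables (R : realType) (H : dvHyperfieldType R).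
Implicit Types (x y z : H) (i j k : int).

(* k is meant to be i + j; keeping it as a parameter avoids casts. *)
Definition gmul i j k (a : gr H i) (b : gr H j) : gr H k := gcls k (hmul (grep a) (grep b)).

Lemma mpow_mul i j x y : mpow H i x -> mpow H j y -> mpow H (i + j) (hmul x y).
Proof.
move=> /mpowE hx /mpowE hy; apply/mpowE; rewrite habsM exprzDr ?unitfE ?gt_eqF ?htheta_gt0//.
by rewrite ler_pM ?habs_ge0.
Qed.

Lemma gcls_mul i j k x y : k = i + j -> mpow H i x -> mpow H j y ->
  gmul k (gcls i x) (gcls j y) = gcls k (hmul x y).
Proof.
move=> -> hx hy; rewrite /gmul.
have hx' := @grepP _ _ _ (gcls i x); have hy' := @grepP _ _ _ (gcls j y).
have xx' := grep_near hx; have yy' := grep_near hy.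
set x' := grep _ in hx' xx' *; set y' := grep _ in hy' yy' *.
apply/gcls_eq; [exact: mpow_mul|exact: mpow_mul|].
apply: le_trans (hdist_ultra _ (hmul x y') _) _; rewrite ge_max hdistMr hdistMl.
rewrite exprzDr ?unitfE ?gt_eqF ?htheta_gt0//.
move/mpowE : hy' => hy'; move/mpowE : hx => hx.
apply/andP; split; first by rewrite mulrA ler_pM ?hdist_ge0 ?habs_ge0.
by rewrite mulrCA ler_pM ?hdist_ge0 ?habs_ge0.
Qed.

Lemma gmulDl i j k (a b : gr H i) (c : gr H j) : k = i + j ->
  gmul k (a + b) c = gmul k a c + gmul k b c.
Proof.
move=> kij; elim/grW: a => x hx; elim/grW: b => y hy; elim/grW: c => z hz.
have [t ht] := hadd_nonempty x y.
rewrite [_ + _ in LHS](gcls_add hx hy ht) !gcls_mul//; last exact: mpow_add ht.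
apply/esym/gcls_add; [rewrite kij; exact: mpow_mul..|exact: hmul_Dl].
Qed.

Lemma gmulC i j k (a : gr H i) (b : gr H j) : gmul k a b = gmul k b a.
Proof. by rewrite /gmul hmulC. Qed.

Lemma gmulA i j l k ij jl (a : gr H i) (b : gr H j) (c : gr H l) :
  ij = i + j -> jl = j + l -> k = i + j + l ->
  gmul k a (gmul jl b c) = gmul k (gmul ij a b) c.
Proof.
move=> -> -> ->; elim/grW: a => x hx; elim/grW: b => y hy; elim/grW: c => z hz.
rewrite !gcls_mul ?addrA//; [|exact: mpow_mul..].
by rewrite hmulA.
Qed.

Lemma mpow0_1 : mpow H 0 h1.
Proof. by apply/mpowE; rewrite habs1 expr0z. Qed.

Lemma gmul1 i (a : gr H i) : gmul i (gcls 0 (h1 : H)) a = a.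
Proof.
elim/grW: a => x hx; rewrite gcls_mul ?add0r ?hmul1//; exact: mpow0_1.
Qed.

Lemma mpow0E x : mpow H 0 x <-> habs x <= 1.
Proof. by rewrite mpowE expr0z. Qed.

Lemma mpow1E x : mpow H 1 x <-> habs x <= htheta H.
Proof. by rewrite mpowE expr1z. Qed.

Lemma gcls0_eq0 x : habs x <= 1 -> gcls 0 x = gcls 0 (h0 : H) <-> habs x <= hrho H.
Proof.
move=> x1; have := gcls_eq (proj2 (mpow0E x) x1) (mpow0 H 0).
by rewrite hdist0 expr0z mulr1.
Qed.

Lemma hrho_lt1 : hrho H < 1.
Proof.
rewrite ltNge; apply/negP => r1.
have [_ _ /(_ h1 h0)[c cE] _] := hrho_spec H.
move: cE; rewrite haddr0 habs1 habs0 max_l// mulr1 => cE.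
have c1 : cball c (hrho H) h1 by rewrite -cE.
have : cball c (hrho H) (h0 : H).
  by rewrite (cball_center c1) /cball/= hdist0 habs1.
by rewrite -cE => /= /eqP; rewrite (negbTE (h0_neq1 (s:=H))).
Qed.

Definition tr_ring : Type := gr H 0.
HB.instance Definition _ := GRing.Zmodule.on tr_ring.

Fact tr_ring_mulA : associative (gmul 0 : tr_ring -> tr_ring -> tr_ring).
Proof. by move=> a b c; apply: gmulA. Qed.

Fact tr_ring_mulDl : left_distributive (gmul 0 : tr_ring -> tr_ring -> tr_ring) +%R.
Proof. by move=> a b c; apply: gmulDl. Qed.

Fact tr_ring_1_neq0 : gcls 0 (h1 : H) != 0 :> tr_ring.
Proof.
apply/eqP => /gcls0_eq0; rewrite habs1 => /(_ (lexx _)).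
by rewrite leNgt hrho_lt1.
Qed.

HB.instance Definition _ := GRing.Zmodule_isComNzRing.Build tr_ring
  tr_ring_mulA (@gmulC 0 0 0) (@gmul1 0) tr_ring_mulDl tr_ring_1_neq0.

Section ScaleGr.
Variable i : int.

Definition gscale (a : tr_ring) (b : gr H i) : gr H i := gmul i a b.

Fact gscaleA a b c : gscale a (gscale b c) = gscale (a * b) c.
Proof. by apply: gmulA; rewrite ?add0r. Qed.
Fact gscale1 : left_id 1 gscale.
Proof. exact: gmul1. Qed.
Fact gscaleDr : right_distributive gscale +%R.
Proof.
move=> a b c; rewrite /gscale (gmulC i a (b + c)) (gmulC i a b) (gmulC i a c).
by apply: gmulDl; rewrite addr0.
Qed.
Fact gscaleDl b : {morph gscale^~ b : a c / a + c}.
Proof. by move=> a c; rewrite /gscale gmulDl ?add0r. Qed.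

HB.instance Definition _ := GRing.Zmodule_isLmodule.Build tr_ring (gr H i)
  gscaleA gscale1 gscaleDr gscaleDl.

Lemma gcls_scale x y : mpow H 0 x -> mpow H i y ->
  (gcls 0 x : tr_ring) *: gcls i y = gcls i (hmul x y).
Proof. by move=> hx hy; apply: gcls_mul; rewrite ?add0r. Qed.

Lemma gcls_unif_generator (p : H) : uniformizer p ->
  is_generator (gcls i (hexpz p i)).
Proof.
move=> up; have ap := habs_unifXz i up.
have p0 : hexpz p i != h0 by rewrite -habs_gt0 ap hthetaXz_gt0.
have pi_ : mpow H i (hexpz p i) by apply/mpowE; rewrite ap.
elim/grW=> x /[dup] hx /mpowE ax.
have q0 : mpow H 0 (hmul x (hinv (hexpz p i))).
  by apply/mpow0E; rewrite habsM habsV// ap ler_pdivrMr ?hthetaXz_gt0// mul1r.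
have qE : hmul (hmul x (hinv (hexpz p i))) (hexpz p i) = x.
  by rewrite -hmulA [hmul (hinv _) _]hmulC hmulV// hmul1r.
exists (gcls 0 (hmul x (hinv (hexpz p i)))); split.
  by rewrite gcls_scale// qE.
elim/grW=> y hy; rewrite gcls_scale// -{1}qE.
move=> e; apply/gcls_eq => //.
have /gcls_eq : gcls i (hmul (hmul x (hinv (hexpz p i))) (hexpz p i)) = gcls i (hmul y (hexpz p i)) by [].
rewrite hdistMr ap ler_pM2r ?hthetaXz_gt0// expr0z mulr1; apply.
  by rewrite qE.
by rewrite -[i in mpow H i]add0r; exact: mpow_mul.
Qed.

End ScaleGr.

Definition tr_eps (a : gr H 1) : tr_ring := gcls 0 (grep a).

Lemma mpow10 x : mpow H 1 x -> mpow H 0 x.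
Proof.
by move/mpow1E => hx; apply/mpow0E; apply: le_trans hx _; exact/ltW/htheta_lt1.
Qed.

Lemma tr_epsE x : mpow H 1 x -> tr_eps (gcls 1 x) = gcls 0 x.
Proof.
move=> hx; apply/gcls_eq; [exact/mpow10/grepP|exact: mpow10|].
apply: le_trans (grep_near hx) _.
by rewrite expr0z expr1z ler_wpM2l ?(ltW (hrho_gt0 H))// ltW// htheta_lt1.
Qed.

Fact tr_eps_linear : linear (tr_eps : gr H 1 -> tr_ring^o).
Proof.
elim/grW=> a ha; elim/grW=> x hx; elim/grW=> y hy; rewrite gcls_scale//.
have hax : mpow H 1 (hmul a x) by rewrite -[1]add0r; exact: mpow_mul.
have [z hz] := hadd_nonempty (hmul a x) y.
have hz1 := mpow_add hax hy hz.
rewrite [_ + _ in LHS](gcls_add hax hy hz) !tr_epsE//.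
rewrite [_ *: _](gcls_mul (k := 0) _ ha (mpow10 hx))//.
by apply/esym/gcls_add => //; exact: mpow10.
Qed.

HB.instance Definition _ :=
  GRing.isLinear.Build tr_ring (gr H 1) tr_ring^o *:%R tr_eps tr_eps_linear.

Lemma tr_dvd x y : mpow H 0 x -> habs y <= habs x ->
  exists a : tr_ring, gcls 0 y = a * gcls 0 x :> tr_ring.
Proof.
move=> hx yx; have [x0|x0] := eqVneq x h0.
  have -> : y = h0 by apply/habs_eq0/eqP; rewrite eq_le habs_ge0 -(habs0 H) -x0 yx.
  by exists 0; rewrite mul0r.
have hq : mpow H 0 (hmul y (hinv x)).
  by apply/mpow0E; rewrite habsM habsV// ler_pdivrMr ?habs_gt0// mul1r.
exists (gcls 0 (hmul y (hinv x))); rewrite [RHS](gcls_mul (k := 0) _ hq hx)//.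
by rewrite -hmulA [hmul (hinv _) _]hmulC hmulV// hmul1r.
Qed.

Definition tr_max : set tr_ring := [set gcls 0 x | x in mpow H 1].

Lemma tr_eps_range : range (tr_eps : gr H 1 -> tr_ring) = tr_max.
Proof.
apply/seteqP; split=> _ [x hx <-]; last by exists (gcls 1 x) => //; exact: tr_epsE.
by exists (grep x) => //; exact: grepP.
Qed.

Lemma tr_max_ideal : is_ideal tr_max.
Proof.
split.
- by exists h0 => //; exact: mpow0.
- move=> _ _ [x hx <-] [y hy <-]; have [z hz] := hadd_nonempty x y.
  exists z; first exact: mpow_add hz.
  by apply/esym/gcls_add => //; exact: mpow10.
- move=> a _ [x hx <-]; elim/grW: a => y hy; exists (hmul y x).
    by rewrite -[1]add0r; exact: mpow_mul.
  by apply/esym/gcls_mul => //; exact: mpow10.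
Qed.

Lemma tr_max_proper : ~ tr_max 1.
Proof.
move=> [x /mpow1E hx xE]; have x1 : habs x < 1 by apply: le_lt_trans hx (htheta_lt1 H).
have /gcls_eq := xE; rewrite expr0z mulr1 => /(_ _ mpow0_1) h.
have {}h : hdist h1 x <= hrho H by rewrite hdist_sym; apply/h/mpow0E/ltW.
have := habs_hdist h1 x; rewrite habs1 le_max => /orP[]; rewrite leNgt ?x1//.
by rewrite (le_lt_trans h hrho_lt1).
Qed.

Lemma tr_max_max (I : set tr_ring) : is_ideal I -> ~ I 1 -> I `<=` tr_max.
Proof.
move=> [I0 Iadd Imul] I1 a; elim/grW: a => x hx Ix.
have [x1|x1] := ltP (habs x) 1; first by exists x => //; apply/mpow1E/htheta_max.
exfalso; apply: I1; have [|a aE] := @tr_dvd x h1 hx; first by rewrite habs1.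
by rewrite [1]aE; exact: Imul.
Qed.

Lemma tr_maxP : is_maximal_ideal tr_max.
Proof.
split; [exact: tr_max_ideal|exact: tr_max_proper|].
by move=> I Ii I1 mI; apply/seteqP; split=> //; exact: tr_max_max.
Qed.

Lemma tr_local : is_local tr_ring.
Proof.
exists tr_max; split; first exact: tr_maxP.
move=> m [mi m1 mmax]; apply: mmax; [exact: tr_max_ideal|exact: tr_max_proper|].
exact: tr_max_max.
Qed.

Lemma hexp_mpow0 (p : H) n : uniformizer p -> mpow H 0 (hexp p n).
Proof.
move=> up; apply/mpow0E; rewrite habsX (up : _ = _).
by apply: exprn_ile1; apply/ltW; [exact: htheta_gt0|exact: htheta_lt1].
Qed.

Lemma tr_artinian : is_artinian tr_ring.
Proof.
have [p up] := ex_uniformizer H.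
have [_ _ _ [v v0 vr]] := hrho_spec H.
have [n0 n0E] : exists n, hrho H = htheta H ^+ n.
  by rewrite -vr; apply: habs_thetaX => //; rewrite vr ltW// hrho_lt1.
pose P n : tr_ring := gcls 0 (hexp p n).
have Pn0 : P n0 = 0.
  apply/gcls0_eq0; first exact/mpow0E/hexp_mpow0.
  by rewrite habsX (up : _ = _) n0E.
move=> I Iid Idec.
have Isub n N : (N <= n)%N -> I n `<=` I N.
  move=> /subnK <-; elim: (n - N)%N => [|k IH] x //; rewrite addSn => /Idec; exact: IH.
pose Q (k : nat) := `[< exists N : nat, forall j : nat, (j < k)%N -> ~ I N (P j) >].
have Q0 : exists k : nat, Q k by exists 0%N; apply/asboolP; exists 0%N.
have Qb (k : nat) : Q k -> (k <= n0)%N.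
  move=> /asboolP[N h]; rewrite leqNgt; apply/negP => /h; apply.
  by rewrite Pn0; have [] := Iid N.
case: (ex_maxnP Q0 Qb) => k /asboolP[N hN] kmax; exists N => n Nn.
apply/seteqP; split; first exact: Isub.
have Pk : I n (P k).
  have nQ : ~ Q k.+1 by move=> /kmax; rewrite ltnn.
  apply: contrapT => nPk; apply: nQ; apply/asboolP; exists n => j.
  rewrite ltnS leq_eqVlt => /orP[/eqP -> //|/hN h /(Isub _ _ Nn)]; exact: h.
move=> a; elim/grW: a => x hx Ix.
have [_ _ Imul] := Iid n; have [_ _ ImulN] := Iid N.
suff xk : habs x <= habs (hexp p k).
  have [a ->] := tr_dvd (hexp_mpow0 k up) xk; exact: Imul.
have [->|x0] := eqVneq x h0; first by rewrite habs0 habs_ge0.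
have [j xj] := habs_thetaX x0 (proj1 (mpow0E x) hx).
have jE : habs (hexp p j) = habs x by rewrite habsX (up : _ = _).
have Pj : I N (P j).
  have [|a aE] := @tr_dvd x (hexp p j) hx; first by rewrite jE.
  by rewrite /P aE; exact: ImulN.
rewrite xj habsX (up : _ = _) ler_wiXn2l ?ltW ?htheta_gt0 ?htheta_lt1//.
by rewrite leqNgt; apply/negP => /hN.
Qed.

Lemma tr_principal (m : set tr_ring) : is_maximal_ideal m -> is_principal m.
Proof.
move=> [mi m1 mmax].
have <- : tr_max = m by apply: mmax; [exact: tr_max_ideal|exact: tr_max_proper|exact: tr_max_max].
have [p up] := ex_uniformizer H.
have hp : mpow H 1 p by apply/mpow1E; rewrite (up : _ = _).
exists (gcls 0 p); apply/seteqP; split=> _ [x hx <-].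
  have [|a ->] := @tr_dvd p x (mpow10 hp); last by exists a.
  by rewrite (up : _ = _); apply/mpow1E.
have [_ _] := tr_max_ideal; apply; by exists p.
Qed.

Lemma tr_free : free_rank1 (gr H 1).
Proof. by have [p up] := ex_uniformizer H; exists (gcls 1 (hexpz p 1)); exact: gcls_unif_generator. Qed.

Lemma tr_image : is_maximal_ideal (range (tr_eps : gr H 1 -> tr_ring)).
Proof. by rewrite tr_eps_range; exact: tr_maxP. Qed.

Definition Tr : triple := @Triple tr_ring (gr H 1) tr_eps
  (And3 tr_local tr_artinian tr_principal) tr_free tr_image.

(* Independent of the uniformizer p; sends the class of p^i to the i-th tensor
   power of the class of p. *)
Definition gr_tpow (p : H) i (a : gr H i) : tpow (gr H 1) i :=
  coord1 (gcls i (hexpz p i)) a *: tpure (gcls 1 p) i.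

Lemma gr_tpow_linear (p : H) i : uniformizer p -> linear (@gr_tpow p i).
Proof.
move=> up a x y; rewrite /gr_tpow (coord1_linear (gcls_unif_generator (i := i) up)).
by rewrite scalerDl scalerA.
Qed.

Lemma gr_tpowE (p : H) i : uniformizer p ->
  gr_tpow p (gcls i (hexpz p i)) = tpure (gcls 1 p) i.
Proof.
move=> up; rewrite /gr_tpow -[X in coord1 _ X]scale1r coord1Z ?scale1r//.
exact: gcls_unif_generator.
Qed.

End GradedRing.
Arguments Tr {R} H.

Definition valued_hyperfield_morphism (R : realType) (H H' : valuedHyperfieldType R)
    (f : H -> H') := [/\
  forall x y, f (hmul x y) = hmul (f x) (f y),
  forall a b, range f a -> range f b ->
    f @^-1` (hadd a b) = hset_add (f @^-1` [set a]) (f @^-1` [set b]),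
  forall x, habs (f x) = habs x &
  is_ball (f @^-1` [set h1])].

(* Every element of M_0 and M_1 is a class, so g is determined by f. *)
Definition is_Tr (R : realType) (H H' : dvHyperfieldType R) (f : H -> H')
    (g : triple_hom (Tr H) (Tr H')) := [/\
  (hom_deg g)%:~R = ln (htheta H) / ln (htheta H'),
  forall x, mpow H 0 x -> hom_ring g (gcls 0 x) = gcls 0 (f x) &
  forall p, uniformizer p -> forall x, mpow H 1 x ->
    hom_mod g (gcls 1 x) = gr_tpow p (gcls (hom_deg g) (f x))].

(* Main.v *)
(* A morphism f preserves norms and satisfies f(x + y) <= f(x) + f(y), hence it
   is 1-Lipschitz.  Since 1 - 1 is the closed ball of radius rho about 0 in both
   hyperfields, rho_H <= rho_H', and |f(pi)| = theta_H is a power theta_H'^n.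
   So f descends to additive maps M_i -> M'_j whenever theta_H^i = theta_H'^j,
   and these are compatible with products.  The class of f(pi) generates M'_n,
   so the base change of eta sends a basis to a basis. *)
Require Import Defs.
From mathcomp Require Import all_boot all_order all_algebra.
From mathcomp Require Import reals.
From HB Require Import structures.
From mathcomp Require Import boolp classical_sets exp.

Set Implicit Arguments.
Unset Strict Implicit.
Unset Printing Implicit Defensive.

Import Order.TTheory GRing.Theory Num.Theory.

Local Open Scope classical_set_scope.
Local Open Scope ring_scope.

(** * Free modules of rank one and base change *)

Lemma generator_scale (A : comNzRingType) (M : lmodType A) (x y : M) (u v : A) :
  is_generator x -> y = u *: x -> x = v *: y -> is_generator y.
Proof.
move=> gx yE xE.
have uv : u * v = 1.
  by apply: (generator_inj gx); rewrite mulrC -scalerA -yE -xE scale1r.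
move=> z; exists (coord1 x z * v); split; first by rewrite -scalerA -xE -coord1K.
by move=> c ->; rewrite yE scalerA coord1Z// -mulrA uv mulr1.
Qed.

(** Since [x] generates [M], every tensor has the form [ptens x b]. Base change sends it to
    [b *: eta x], and the coordinate along [eta x] recovers [b]. *)
Lemma base_change_bij (A B : comNzRingType) (f : {rmorphism A -> B})
    (M : lmodType A) (N : lmodType B) (eta : {linear M -> N | f \; *:%R}) (x : M) :
  is_generator x -> is_generator (eta x) ->
  bijective (base_change_map (f := f) eta).
Proof.
move=> gx gy; have bil := base_change_bilinear eta.
have bcE (b : restrict_scalars B^o f) :
    base_change_map eta (ptens x b) = (b : B) *: eta x.
  by rewrite /base_change_map tensor_lift_ptens.
have pure (t : tensor M (restrict_scalars B^o f)) : exists b, t = ptens x b.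
  elim/tensor_ind: t => [|m b|t u [b ->] [c ->]].
  - by exists 0; rewrite -[X in ptens _ X](scale0r 0) ptensZr scale0r.
  - by exists (coord1 x m *: b); rewrite ptensZr -ptensZl -coord1K.
  - by exists (b + c); rewrite ptensDr.
exists (fun n => ptens x (coord1 (eta x) n : restrict_scalars B^o f)) => [t|n]; last by rewrite bcE -coord1K.
by have [b ->] := pure t; rewrite bcE coord1Z.
Qed.

(** * Classes in the graded pieces of one hyperfield *)

Section GradedClasses.
Variables (R : realType) (H : dvHyperfieldType R).

(** The sum [1 - 1] is a closed ball of radius [hrho H] containing 0, and every point of an
    ultrametric ball is a centre. *)
Lemma hsub11E (z : H) : hsub h1 h1 z <-> habs z <= hrho H.
Proof.
have [_ _ /(_ h1 (hopp h1))[c cE] _] := hrho_spec H.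
rewrite habsN habs1 maxxx mulr1 in cE.
have c0 : cball c (hrho H) (h0 : H) by rewrite -cE; exact: hsubrr.
by rewrite /hsub cE (cball_center c0) /cball /= hdist_sym hdist0.
Qed.

(** As [htheta H ^+ n <= 1], the relation defining M_n is finer than the one defining R. *)
Lemma gcls0_congr (n : nat) (x y : H) : mpow H n x -> mpow H n y ->
  gcls n x = gcls n y -> gcls 0 x = gcls 0 y.
Proof.
have tn : htheta H ^+ n <= 1.
  by apply: exprn_ile1; apply/ltW; [exact: htheta_gt0|exact: htheta_lt1].
have m0 z : mpow H n z -> mpow H 0 z.
  by move=> /mpowE hz; apply/mpow0E; exact: le_trans hz tn.
move=> hx hy /(gcls_eq hx hy) xy; apply/gcls_eq; [exact: m0..|].
by apply: le_trans xy _; rewrite expr0z ler_wpM2l// ltW// hrho_gt0.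
Qed.

(** The quotients of [x] and [hexpz p i] have norm 1, so their classes differ by a unit of R. *)
Lemma gcls_generator (i : int) (x : H) : habs x = htheta H ^ i ->
  is_generator (gcls i x).
Proof.
move=> ax; have [p up] := ex_uniformizer H.
have ap := habs_unifXz i up.
have xn0 : x != h0 by rewrite -habs_gt0 ax hthetaXz_gt0.
have pn0 : hexpz p i != h0 by rewrite -habs_gt0 ap hthetaXz_gt0.
have mx : mpow H i x by apply/mpowE; rewrite ax.
have mp : mpow H i (hexpz p i) by apply/mpowE; rewrite ap.
pose u := hmul x (hinv (hexpz p i)); pose v := hmul (hexpz p i) (hinv x).
have mu : mpow H 0 u by apply/mpow0E; rewrite habsM habsV// ap ax mulfV// gt_eqF ?hthetaXz_gt0.
have mv : mpow H 0 v by apply/mpow0E; rewrite habsM habsV// ap ax mulfV// gt_eqF ?hthetaXz_gt0.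
have uE : gcls i x = (gcls 0 u : tr_ring H) *: gcls i (hexpz p i).
  by rewrite gcls_scale// /u -hmulA [hmul (hinv _) _]hmulC hmulV// hmul1r.
have vE : gcls i (hexpz p i) = (gcls 0 v : tr_ring H) *: gcls i x.
  by rewrite gcls_scale// /v -hmulA [hmul (hinv _) _]hmulC hmulV// hmul1r.
exact: generator_scale (@gcls_unif_generator _ _ i p up) uE vE.
Qed.

Lemma gcls_exp (p : H) n : mpow H 0 p ->
  gcls 0 (hexp p n) = (gcls 0 p : tr_ring H) ^+ n.
Proof.
move=> hp; elim: n => [//|n IH]; rewrite exprS -IH.
have hpn : mpow H 0 (hexp p n).
  by apply/mpow0E; rewrite habsX exprn_ile1 ?habs_ge0//; apply/mpow0E.
exact/esym/(gcls_mul (k := 0)).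
Qed.

(** Write [p = u q] with [u] of norm 1. The class of p^n and the n-th tensor power of the class of p
    both acquire the factor u^n, so the two identifications agree. *)
Lemma gr_tpow_indep (p q : H) (n : nat) (a : gr H n) :
  uniformizer p -> uniformizer q -> gr_tpow p a = gr_tpow q a.
Proof.
move=> up uq; have p0 := uniformizer_neq0 up; have q0 := uniformizer_neq0 uq.
pose u := hmul p (hinv q).
have mu : mpow H 0 u.
  by apply/mpow0E; rewrite habsM habsV// (up : _ = _) (uq : _ = _) mulfV// gt_eqF ?htheta_gt0.
have mq : mpow H 1 q by apply/mpow1E; rewrite (uq : _ = _).
have pE : p = hmul u q by rewrite /u -hmulA [hmul (hinv _) _]hmulC hmulV// hmul1r.
have cp : gcls 1 p = (gcls 0 u : tr_ring H) *: gcls 1 q by rewrite gcls_scale// -pE.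
have pnE m : hexp p m = hmul (hexp u m) (hexp q m).
  elim: m => [|m IH] /=; first by rewrite hmul1.
  by rewrite IH {1}pE !hmulA; congr hmul; rewrite -!hmulA [hmul q _]hmulC.
have mun : mpow H 0 (hexp u n).
  by apply/mpow0E; rewrite habsX exprn_ile1 ?habs_ge0//; apply/mpow0E.
have mqn : mpow H n (hexp q n).
  by apply/mpowE; rewrite habsX (uq : _ = _).
have gp := @gcls_unif_generator _ _ n p up; have gq := @gcls_unif_generator _ _ n q uq.
have cpn : gcls n (hexpz p n) = (gcls 0 u : tr_ring H) ^+ n *: gcls n (hexpz q n).
  by rewrite -gcls_exp// gcls_scale// -pnE.
rewrite [in RHS](coord1K gp a) cpn scalerA /gr_tpow coord1Z//.
by rewrite cp [tpure _ _]tpure_natZ scalerA -cpn.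
Qed.

(** Under M_n = M^(n), [tensor_eps] from degree n to 0 is induced by the inclusion of m^n in O. If
    the class of [x] is [e] times that of p^n in M_n, both sides are [e] times the class of p^n in
    R. *)
Lemma tensor_eps_gr_tpow (p : H) (n : nat) (x : H) : uniformizer p -> mpow H n x ->
  tensor_eps (@tr_eps R H : gr H 1 -> (tr_ring H)^o) 0 n (gr_tpow p (gcls n x))
    = gcls 0 x.
Proof.
move=> up hx; have mp : mpow H 1 p by apply/mpow1E; rewrite (up : _ = _).
have [epsL epsE] := @tensor_epsP _ _ (@tr_eps R H) 0 n (tr_free H)
  (@tr_eps_linear R H) isT.
have gp1 : is_generator (gcls 1 p) by apply: gcls_generator; rewrite expr1z.
have mpn : mpow H n (hexp p n) by apply/mpowE; rewrite habsX (up : _ = _).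
have eps0 : tensor_eps (@tr_eps R H : gr H 1 -> (tr_ring H)^o) 0 n 0 = 0.
  by apply: add_self_eq0; have := epsL 1 0 0; rewrite !scale1r !addr0.
set e := coord1 (gcls n (hexpz p n)) (gcls n x).
have xE : gcls n x = e *: gcls n (hexpz p n) := coord1K (@gcls_unif_generator _ _ n p up) _.
rewrite /gr_tpow -/e -[_ *: _ in LHS]addr0 epsL eps0 addr0 epsE// subr0 absz_nat.
rewrite tr_epsE// -gcls_exp; last exact: mpow10.
(* The zeroth tensor power is R itself, with generator 1. *)
rewrite [X in e *: X]mulr1.
elim/grW: e xE => z hz; rewrite gcls_scale// => xE.
rewrite [LHS](gcls_mul (k := 0))//; last exact: hexp_mpow0.
(* The equality [xE] holds in M_n and is pushed down to R. *)
apply/esym/(gcls0_congr hx _ xE).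
by rewrite -[Posz n]add0r; exact: mpow_mul.
Qed.

End GradedClasses.

(** * Norm and distance estimates for a morphism *)

Section Morphism.
Variables (R : realType) (H H' : dvHyperfieldType R) (f : H -> H').
Hypothesis hf : valued_hyperfield_morphism f.

Lemma morph_mul x y : f (hmul x y) = hmul (f x) (f y).
Proof. by have [] := hf. Qed.

Lemma morph_abs x : habs (f x) = habs x.
Proof. by have [] := hf. Qed.

Lemma morph0 : f h0 = h0.
Proof. by apply/habs_eq0; rewrite morph_abs habs0. Qed.

(** [f h1] is idempotent, and nonzero because its norm is 1, so it can be cancelled. *)
Lemma morph1 : f h1 = h1.
Proof.
have n0 : f h1 != h0 by rewrite -habs_gt0 morph_abs habs1.
have [y fy] := hmul_inv _ n0.
have /(congr1 (hmul^~ y)) := morph_mul h1 h1.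
by rewrite hmul1 -hmulA fy hmul1r => /esym.
Qed.

(** The preimage axiom at [f x] and [f y] applies: [z] lies in the sum of the fibres through [x] and
    [y]. *)
Lemma morph_add x y z : hadd x y z -> hadd (f x) (f y) (f z).
Proof.
have [_ + _ _] := hf => /(_ (f x) (f y)) fD xyz.
suff : (f @^-1` hadd (f x) (f y)) z by [].
by rewrite fD; [exists x => //; exists y|exists x|exists y].
Qed.

Lemma morph_opp x : f (hopp x) = hopp (f x).
Proof. by apply: hopp_uniq; rewrite -morph0; apply: morph_add; exact: hsubrr. Qed.

Lemma hdist_morph x y : hdist (f x) (f y) <= hdist x y.
Proof.
have [z xyz ->] := hdist_ex x y; rewrite -morph_abs; apply: hdist_le.
by rewrite /hsub -morph_opp; exact: morph_add.
Qed.

(** An element [v] of norm [hrho H] lies in [1 - 1], so its image lies in [1 - 1] with the same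
    norm. *)
Lemma hrho_morph : hrho H <= hrho H'.
Proof.
have [_ _ _ [v _ vr]] := hrho_spec H.
rewrite -vr -morph_abs; apply/hsub11E.
rewrite /hsub -morph1 -morph_opp; apply: morph_add.
by apply/hsub11E; rewrite vr.
Qed.

Lemma htheta_morph : exists n : nat, htheta H = htheta H' ^+ n.
Proof.
have [p [p0 p1 up]] := htheta_spec H; rewrite -(up : _ = _) -morph_abs.
by apply: habs_thetaX; [rewrite -habs_gt0 morph_abs habs_gt0|rewrite morph_abs ltW].
Qed.

(** * Descent of the morphism to graded pieces *)

Section GrMap.
Variables i j : int.
Hypothesis ij : htheta H ^ i = htheta H' ^ j.

Definition gr_map (a : gr H i) : gr H' j := gcls j (f (grep a)).

Lemma mpow_morph x : mpow H i x -> mpow H' j (f x).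
Proof. by move=> /mpowE hx; apply/mpowE; rewrite morph_abs -ij. Qed.

(** Independence of the representative: [f] does not increase distances, and the tolerance in M_i is
    at most the one in M'_j by [hrho_morph]. *)
Lemma gr_mapE x : mpow H i x -> gr_map (gcls i x) = gcls j (f x).
Proof.
move=> hx; apply/gcls_eq; [exact/mpow_morph/grepP|exact: mpow_morph|].
apply: le_trans (hdist_morph _ _) _; apply: le_trans (grep_near hx) _.
by rewrite ij ler_wpM2r ?hrho_morph// ltW// hthetaXz_gt0.
Qed.

Lemma gr_mapD : {morph gr_map : a b / a + b}.
Proof.
elim/grW=> x hx; elim/grW=> y hy; have [z hz] := hadd_nonempty x y.
rewrite [_ + _ in LHS](gcls_add hx hy hz) !gr_mapE//; last exact: mpow_add hz.
by apply/esym/gcls_add; [exact: mpow_morph..|exact: morph_add].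
Qed.

End GrMap.
Arguments gr_map : clear implicits.

(** Gives multiplicativity of phi in degrees 0, 0 and semilinearity of eta in degrees 0, 1. *)
Lemma gr_map_mul (i i' k j j' l : int) (a : gr H i) (b : gr H i') :
  htheta H ^ i = htheta H' ^ j -> htheta H ^ i' = htheta H' ^ j' ->
  k = i + i' -> l = j + j' ->
  gr_map k l (gmul k a b) = gmul l (gr_map i j a) (gr_map i' j' b).
Proof.
move=> ij ij' kE lE; elim/grW: a => x hx; elim/grW: b => y hy.
have kl : htheta H ^ k = htheta H' ^ l.
  by rewrite kE lE !exprzDr ?unitfE ?gt_eqF ?htheta_gt0// ij ij'.
rewrite gcls_mul// (gr_mapE kl); last by rewrite kE; exact: mpow_mul.
rewrite (gr_mapE ij)// (gr_mapE ij')// gcls_mul ?morph_mul//.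
  exact: mpow_morph ij _ hx.
exact: mpow_morph ij' _ hy.
Qed.

(** * The ring homomorphism phi *)

Let theta0 : htheta H ^ 0 = htheta H' ^ 0. Proof. by rewrite !expr0z. Qed.

Definition tr_map : tr_ring H -> tr_ring H' := gr_map 0 0.

Fact tr_map_zmod : zmod_morphism tr_map.
Proof.
(* Compatibility with subtraction is reduced to additivity by adding [tr_map b]. *)
move=> a b; apply: (addIr (tr_map b)).
by rewrite subrK -[LHS](gr_mapD theta0) subrK.
Qed.

Fact tr_map_monoid : monoid_morphism tr_map.
Proof.
split; first by rewrite [LHS](gr_mapE theta0 (mpow0_1 H)) morph1.
by move=> a b; exact: (gr_map_mul (k := 0) (l := 0) a b theta0 theta0).
Qed.

Definition tr_rmorph : {rmorphism tr_ring H -> tr_ring H'} :=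
  HB.pack tr_map (GRing.isZmodMorphism.Build _ _ tr_map tr_map_zmod)
    (GRing.isMonoidMorphism.Build _ _ tr_map tr_map_monoid).

(** * The semilinear map eta and the triple axioms *)

Section Degree.
Variables (n : nat) (p : H').
Hypothesis thetaE : htheta H = htheta H' ^+ n.
Hypothesis up : uniformizer p.

Let theta1 : htheta H ^ 1 = htheta H' ^ n. Proof. by rewrite expr1z thetaE. Qed.

Definition tr_mod_map (a : gr H 1) : tpow (gr H' 1) n := gr_tpow p (gr_map 1 n a).

Fact tr_mod_map_linear : linear_for (tr_rmorph \; *:%R) tr_mod_map.
Proof.
move=> a x y; rewrite /tr_mod_map.
have aE : gr_map 1 n (a *: x) = tr_map a *: gr_map 1 n x.
  by apply: (gr_map_mul a x theta0 theta1); rewrite add0r.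
rewrite (gr_mapD theta1) aE.
exact: (gr_tpow_linear up).
Qed.

Definition tr_linear : {linear gr H 1 -> tpow (gr H' 1) n | tr_rmorph \; *:%R} :=
  HB.pack tr_mod_map (GRing.isLinear.Build _ _ _ _ tr_mod_map tr_mod_map_linear).

Lemma tr_linearE x : mpow H 1 x -> tr_linear (gcls 1 x) = gr_tpow p (gcls n (f x)).
Proof. by move=> hx; rewrite [LHS]/(gr_tpow p (gr_map 1 n _)) (gr_mapE theta1). Qed.

Lemma tr_rmorphE x : mpow H 0 x -> tr_rmorph (gcls 0 x) = gcls 0 (f x).
Proof. exact: (gr_mapE theta0). Qed.

Lemma tr_hom_eps x : tr_rmorph (tr_eps x) =
  tensor_eps (@tr_eps R H' : gr H' 1 -> (tr_ring H')^o) 0 n (tr_linear x).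
Proof.
elim/grW: x => x hx; rewrite tr_epsE// tr_rmorphE; last exact: mpow10.
by rewrite tr_linearE// tensor_eps_gr_tpow//; exact: mpow_morph theta1 _ hx.
Qed.

(** Both [a] and the class of p^n generate M'_n, so the coordinate of [a] is a unit with inverse
    [v], and the image is a unit multiple of the generator [tpure (gcls 1 p) n]. *)
Lemma gr_tpow_generator (a : gr H' n) : is_generator a -> is_generator (gr_tpow p a).
Proof.
move=> ga; have gpn := @gcls_unif_generator _ _ n p up.
have gp : is_generator (gcls 1 p) by apply: gcls_generator; rewrite expr1z.
have gt := tpure_generator (i := n) gp.
have [v [vE _]] := ga (gcls n (hexpz p n)).
apply: (@generator_scale _ _ _ _ (coord1 (gcls n (hexpz p n)) a) v gt) => //.
rewrite /gr_tpow scalerA; have -> : v * coord1 (gcls n (hexpz p n)) a = 1.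
  by apply: (generator_inj gpn); rewrite -scalerA -coord1K// -vE scale1r.
by rewrite scale1r.
Qed.

Lemma tr_hom_iso : bijective (base_change_map (f := tr_rmorph) tr_linear).
Proof.
have [q uq] := ex_uniformizer H.
have mq : mpow H 1 q by apply/mpow1E; rewrite (uq : _ = _).
apply: (@base_change_bij _ _ _ _ _ tr_linear (gcls 1 q)).
  by apply: gcls_generator; rewrite expr1z.
rewrite tr_linearE//; apply/gr_tpow_generator/gcls_generator.
by rewrite morph_abs (uq : _ = _) thetaE.
Qed.

Definition tr_triple_hom : triple_hom (Tr H) (Tr H') :=
  @TripleHom (Tr H) (Tr H') n tr_rmorph tr_linear isT tr_hom_eps tr_hom_iso.

End Degree.
End Morphism.

Theorem theorem5p7 (R : realType) (H H' : dvHyperfieldType R) (f : H -> H')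
    (hf : valued_hyperfield_morphism f) :
  exists g : triple_hom (Tr H) (Tr H'), is_Tr f g.
Proof.
have [n thetaE] := htheta_morph hf; have [p up] := ex_uniformizer H'.
exists (tr_triple_hom hf thetaE up); split=> /= [|x hx|q uq x hx].
- have ln0 : ln (htheta H') != 0 by rewrite lt_eqF// ln_lt0// htheta_gt0 htheta_lt1.
  by rewrite thetaE lnXn ?htheta_gt0// -mulr_natl mulfK.
- exact: tr_rmorphE.
(* The map eta was built from [p], while the condition concerns an arbitrary uniformizer [q]. *)
- by rewrite [LHS](tr_linearE hf thetaE up hx); exact: gr_tpow_indep.
Qed.
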